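(* Let $f\in L^\infty(0,1)$ with $0\le f\le1$ a.e. on $[0,1]$, let $F:\mathbb{R}\to[0,\infty)$ satisfy (F1)--(F5) with exponent $\mu\in(1,2]$ in (F5), and let $\lambda>0$ be any fixed number. Then the unique minimizer $u\in BV(0,1)$ of $K$ in $BV(0,1)$ is of class $C^{1,1}([0,1])$.
   Context: Conditions on $F:\mathbb{R}\to[0,\infty)$ (for all $p\in\mathbb{R}$, with constants $\nu_1,\nu_2,c_1>0$, $\nu_3\in\mathbb{R}$): (F1) $F\in C^2(\mathbb{R})$, $F(-p)=F(p)$, $F(0)=0$; (F2) $|F'(p)|\le\nu_1$; (F3) $F(p)\ge\nu_2|p|-\nu_3$; (F4) $F''(p)>0$; (F5) ($\mu$-ellipticity) $F''(p)\ge\frac{c_1}{(1+|p|)^\mu}$. Set $\lambda_\infty=\lambda_\infty(F):=\lim_{p\to\infty}F'(p)$, a positive number. For $w\in BV(0,1)$ write the distributional derivative as $Dw=\dot w\,\mathcal{L}^1+D^sw$ (Lebesgue decomposition with respect to Lebesgue measure $\mathcal{L}^1$; $\dot w$ is the density of the absolutely continuous part and $D^sw$ the singular part, $|D^sw|$ its total variation measure), and $$K[w]:=\int_0^1F(\dot w)\,dt+\lambda_\infty|D^sw|(0,1)+\frac{\lambda}{2}\int_0^1(w-f)^2\,dt.$$ Every $BV$-function is identified with its good representative, which is continuous outside an at most countable set of jump points and has left and right limits at all points. $C^{1,1}([0,1])$ is the space of $C^1$ functions on $[0,1]$ with Lipschitz continuous derivative. *)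

(* Defs.v *)
From HB Require Import structures.
From mathcomp Require Import all_boot all_order all_algebra.
From mathcomp Require Import all_classical all_reals all_analysis.

Set Implicit Arguments.
Unset Strict Implicit.
Unset Printing Implicit Defensive.

Import Order.TTheory GRing.Theory Num.Theory.
Import numFieldNormedType.Exports.

Local Open Scope ring_scope.
Local Open Scope classical_set_scope.

(** * The density F *)

Definition class_C2 (R : realType) (F : R -> R) : Prop :=
  [/\ forall p : R, derivable F p 1, forall p : R, derivable F^`() p 1
    & continuous F^`(2)].

Definition condF1 (R : realType) (F : R -> R) : Prop :=
  [/\ class_C2 F, forall p, F (- p) = F p & F 0 = 0].

Definition condF2 (R : realType) (F : R -> R) (nu1 : R) : Prop :=
  forall p, `|F^`() p| <= nu1.

Definition condF3 (R : realType) (F : R -> R) (nu2 nu3 : R) : Prop :=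
  forall p, nu2 * `|p| - nu3 <= F p.

Definition condF4 (R : realType) (F : R -> R) : Prop :=
  forall p, 0 < F^`(2) p.

Definition condF5 (R : realType) (F : R -> R) (c1 mu : R) : Prop :=
  forall p, c1 / (1 + `|p|) `^ mu <= F^`(2) p.

Definition lambda_infty (R : realType) (F : R -> R) : R :=
  lim (F^`() p @[p --> +oo]).

(** * Functions on the unit interval

  A function on (0,1) is a total function [R -> R] of which only the values on
  [I01] matter; elements of Lebesgue spaces are represented by Borel functions,
  equality being [ae_eq lebesgue_measure I01]. *)

Definition I01 (R : realType) : set R := `]0, 1[.
Arguments I01 {R}.

Definition Linfty01 (R : realType) (f : R -> R) : Prop :=
  measurable_fun (I01 : set (measurableTypeR R)) f /\
  exists M : R, {ae lebesgue_measure, forall t, I01 t -> `|f t| <= M}.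

(* Test functions: C_c^infty(0,1). *)
Definition test_fun (R : realType) (phi : R -> R) : Prop :=
  [/\ forall (n : nat) (t : R), derivable phi^`(n) t 1,
      compact (closure [set t | phi t != 0])
    & closure [set t | phi t != 0] `<=` I01].

(** * Signed measures *)

Notation signed_measure R := (charge (measurableTypeR R) R).

Section SignedMeasure.
Context {R : realType}.
Implicit Type nu : signed_measure R.

Definition hahn_pos nu : set (measurableTypeR R) :=
  sval (cid (Hahn_decomposition nu)).

Definition hahn_neg nu : set (measurableTypeR R) :=
  sval (cid (svalP (cid (Hahn_decomposition nu)))).

Lemma hahn_posnegP nu : hahn_decomposition nu (hahn_pos nu) (hahn_neg nu).
Proof. exact: svalP (cid (svalP (cid (Hahn_decomposition nu)))). Qed.

(* The total variation measure |nu|. *)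
Definition variation_measure nu : set (measurableTypeR R) -> \bar R :=
  charge_variation (hahn_posnegP nu).

Definition charge_integral nu (g : R -> R) : R :=
  \int[jordan_pos (hahn_posnegP nu)]_t g t
  - \int[jordan_neg (hahn_posnegP nu)]_t g t.

(* Signed measures on (0,1) are those on the line that vanish off (0,1). *)
Definition carried_by (A : set (measurableTypeR R)) nu : Prop :=
  forall B, measurable B -> B `&` A = set0 -> nu B = 0%E.

Definition lebesgue_singular nu : Prop :=
  exists N : set (measurableTypeR R),
    [/\ measurable N, lebesgue_measure N = 0%E & carried_by N nu].

(* nu = g L^1 + nus on (0,1), with nus singular. *)
Definition is_lebesgue_decomposition nu (g : R -> R) (nus : signed_measure R) :
    Prop :=
  [/\ lebesgue_measure.-integrable I01 (EFin \o g), lebesgue_singular nus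
    & forall B : set (measurableTypeR R), measurable B ->
        nu B = (\int[lebesgue_measure]_(t in B `&` I01) (g t)%:E + nus B)%E].

End SignedMeasure.

(** * BV(0,1) *)

Definition is_distr_derivative (R : realType) (w : R -> R)
    (nu : signed_measure R) : Prop :=
  carried_by I01 nu /\
  forall phi, test_fun phi ->
    \int[lebesgue_measure]_(t in I01) (w t * phi^`()%classic t)
    = - charge_integral nu phi.

Definition BV01 (R : realType) (w : R -> R) : Prop :=
  lebesgue_measure.-integrable I01 (EFin \o w) /\
  exists nu : signed_measure R, is_distr_derivative w nu.

(* The definitions below pick the object described by the relations above: the
   distributional derivative and its singular part are unique, the density is
   unique up to null sets. The default values are never taken on BV. *)

Definition distr_derivative (R : realType) (w : R -> R) : signed_measure R :=
  if pselect (exists nu, is_distr_derivative w nu) is left h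
  then sval (cid h) else czero.

Definition lebesgue_decomposition (R : realType) (nu : signed_measure R) :
    (R -> R) * signed_measure R :=
  if pselect (exists p : (R -> R) * signed_measure R,
                is_lebesgue_decomposition nu p.1 p.2) is left h
  then sval (cid h) else (cst 0, czero : signed_measure R).

Definition ac_density (R : realType) (w : R -> R) : R -> R :=
  (lebesgue_decomposition (distr_derivative w)).1.

Definition singular_part (R : realType) (w : R -> R) : signed_measure R :=
  (lebesgue_decomposition (distr_derivative w)).2.

(* The good representative, viewed on [0,1] through its one-sided limits at the
   end points. *)
Definition jump_point (R : realType) (w : R -> R) (t : R) : Prop :=
  exists l r : R, [/\ w s @[s --> t^'-] --> l, w s @[s --> t^'+] --> r & l != r].

Definition good_representative (R : realType) (w : R -> R) : Prop :=
  [/\ forall t, I01 t -> cvg (w s @[s --> t^'-]) /\ cvg (w s @[s --> t^'+]),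
      countable [set t | I01 t /\ jump_point w t],
      forall t, I01 t -> ~ jump_point w t -> {for t, continuous w},
      w s @[s --> 0^'+] --> w 0
    & w s @[s --> 1^'-] --> w 1].

(** * The functional *)

Definition energyK (R : realType) (F : R -> R) (lam : R) (f w : R -> R) :
    \bar R :=
  (\int[lebesgue_measure]_(t in I01) (F (ac_density w t))%:E
   + (lambda_infty F)%:E * variation_measure (singular_part w) I01
   + (lam / 2)%:E * \int[lebesgue_measure]_(t in I01) ((w t - f t) ^+ 2)%:E)%E.

Definition BV_minimizer (R : realType) (F : R -> R) (lam : R) (f u : R -> R) :
    Prop :=
  BV01 u /\ forall w, BV01 w -> (energyK F lam f u <= energyK F lam f w)%E.

(** * C^{1,1}([0,1]) *)

(* [g] is the derivative of [v] on [0,1], one-sided at the end points. *)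
Definition has_derivative01 (R : realType) (v g : R -> R) : Prop :=
  forall t : R, t \in `[0, 1] ->
    (v s - v t) / (s - t) @[s --> within `[0, 1] t^'] --> g t.

Definition class_C11 (R : realType) (v : R -> R) : Prop :=
  exists g : R -> R,
    [/\ has_derivative01 v g, {within `[0, 1], continuous g}
      & exists k : R, k.-lipschitz_`[0, 1] g].

(* Main.v *)
Require Import Defs.
From HB Require Import structures.
From mathcomp Require Import all_boot all_order all_algebra.
From mathcomp Require Import all_classical all_reals all_analysis.
From mathcomp Require Import measurable_realfun ring lra.

Set Implicit Arguments.
Unset Strict Implicit.
Unset Printing Implicit Defensive.

Import Order.TTheory GRing.Theory Num.Theory.
Import numFieldNormedType.Exports.

Local Open Scope ring_scope.
Local Open Scope classical_set_scope.

(** The minimizer is not extracted from a minimizing sequence.  It is obtained by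
    solving the Euler-Lagrange equation, and convexity then shows that the solution
    beats every competitor.

    Equation.  With the stress [sigma = F' (u')] the Euler-Lagrange equation with
    natural boundary conditions is the first order system [u' = psi sigma],
    [sigma' = lam (u - f)], [sigma 0 = sigma 1 = 0], where [psi] is the inverse of
    [F'].  This inverse blows up at [+-lambda_infty], so it is replaced by a bounded
    Lipschitz nondecreasing function that agrees with it on [[-F' M, F' M]]
    ([truncated_inverse]).  Started from [u 0 = a], [sigma 0 = 0], the truncated
    system has a solution depending continuously on [a], by a Picard iteration that
    contracts an exponentially weighted sup norm on all of [[0, 1]].  As
    [0 <= f <= 1], the iterates for [a = 0] have [sigma 1 <= 0] and those for [a = 1]
    have [sigma 1 >= 0]; the intermediate value theorem gives an [a] with
    [sigma 1 = 0] ([truncated_neumann_problem]).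

    A priori bounds.  A maximum principle gives [0 <= u <= 1], hence
    [|sigma'| <= lam].  If [sigma] reached [F' M] at a time [t], then, going back from
    [t], the stress would be at least [F' p] at time [t - (F' M - F' p) / lam], so
    the slope of [u] would be at least [p] there, and [u] would rise by at least
    [\int_0^M p F''(p) / lam dp >= (c1 / lam) \int_0^M p / (1 + p)^2 dp] when
    [mu <= 2].  This integral diverges as [M] grows, which contradicts
    [0 <= u <= 1] for large [M] ([gradient_bound]).  Hence the truncation is never
    active, [u] solves the original equation, and [u' = psi sigma] is Lipschitz
    because [sigma] is ([euler_lagrange_solution]).  This is the C^{1,1} regularity.

    Minimality.  Let [Dw = w' L^1 + D^s w].  Since [sigma = F' (u')] and
    [|sigma| <= lambda_infty], convexity gives [F w' >= F u' + sigma (w' - u')] and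
    [lambda_infty |D^s w| >= sigma D^s w]; since [sigma] vanishes at both ends,
    integrating [sigma] against [Dw] gives [- \int sigma' w = - \int lam (u - f) w]
    ([BV_energy_ge]).  The expansion of the square in the fidelity term then yields
    [K u + lam / 2 \int (w - u)^2 <= K w] for every [w] in BV
    ([strong_minimality]): [u] is a minimizer and every minimizer agrees with it
    almost everywhere.

    The stress is only Lipschitz, so it is not a test function, and integration by
    parts against [Dw] has to be extended to it.  This is [BV_by_parts]: by Fubini,
    integrating the primitive of [h] against a measure amounts to integrating [h]
    against the tail function of the measure, and the lemma of du Bois-Reymond
    identifies [w] with minus the tail of [Dw] up to a constant. *)

(** * Bounded Borel functions and signed measures *)

Notation finmeas R := {finite_measure set (measurableTypeR R) -> \bar R}.

Definition bounded_borel (R : realType) (phi : R -> R) : Prop :=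
  measurable_fun (setT : set (measurableTypeR R)) phi /\
  exists M : R, forall t, `|phi t| <= M.

Lemma measurable_I01 (R : realType) : measurable (I01 : set (measurableTypeR R)).
Proof. exact: measurable_itv. Qed.
#[global] Hint Resolve measurable_I01 : core.

Lemma bounded_borel_integrable (R : realType) (m : finmeas R) (phi : R -> R)
    (D : set (measurableTypeR R)) :
  measurable D -> bounded_borel phi -> m.-integrable D (EFin \o phi).
Proof.
move=> mD [mphi [M bM]]; apply: measurable_bounded_integrable => //.
- by rewrite ltey_eq fin_num_measure.
- exact: measurable_funTS.
- exists M; split; first exact: num_real.
  by move=> x Mx t _ /=; rewrite (le_trans (bM t))// ltW.
Qed.

Lemma fin_num_subeq (R : realType) (a b c d : \bar R) :
  a \is a fin_num -> b \is a fin_num -> c \is a fin_num -> d \is a fin_num ->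
  (a - b = c - d -> a + d = c + b)%E.
Proof.
case: a b c d => [a| |] [b| |] [c| |] [d| |] //= _ _ _ _.
rewrite -!EFinB -!EFinD => -[] E; congr (_%:E).
by rewrite -[a](subrK b) E; ring.
Qed.

Lemma fin_num_addeq (R : realType) (a b c d : \bar R) :
  a \is a fin_num -> b \is a fin_num -> c \is a fin_num -> d \is a fin_num ->
  (a + d = c + b -> a - b = c - d)%E.
Proof.
case: a b c d => [a| |] [b| |] [c| |] [d| |] //= _ _ _ _.
rewrite -!EFinB -!EFinD => -[] E; congr (_%:E).
by rewrite -[a](addrK d) E; ring.
Qed.

Lemma fin_num_sub0_eq (R : realType) (a b : \bar R) :
  a \is a fin_num -> b \is a fin_num -> (a - b = 0 -> a = b)%E.
Proof.
case: a b => [a| |] [b| |] //= _ _; rewrite -EFinB => -[] /eqP.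
by rewrite subr_eq0 => /eqP ->.
Qed.

Lemma fin_num_subACA (R : realType) (a b c d : \bar R) :
  a \is a fin_num -> b \is a fin_num -> c \is a fin_num -> d \is a fin_num ->
  (a - b + (c - d) = a + c - (b + d))%E.
Proof.
case: a b c d => [a| |] [b| |] [c| |] [d| |] //= _ _ _ _.
by rewrite -!EFinB -!EFinD -?EFinB; congr (_%:E); ring.
Qed.

Lemma fin_num_addKl (R : realType) (a b : \bar R) :
  a \is a fin_num -> b \is a fin_num -> (b = a + b - a)%E.
Proof.
case: a b => [a| |] [b| |] //= _ _.
by rewrite -!EFinD -?EFinB; congr (_%:E); ring.
Qed.

Section charge_integral.
Context {R : realType}.
Implicit Types (nu : signed_measure R) (m : finmeas R).

(** The integral against a signed measure is defined through its Jordan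
    decomposition.  Any other decomposition into finite measures gives the same
    value, since [nu^+ + m2 = m1 + nu^-] as measures; the densities and sums of
    measures met below come with their own decompositions. *)
Lemma charge_integralE nu m1 m2 (phi : R -> R) :
  (forall B, measurable B -> nu B = (m1 B - m2 B)%E) -> bounded_borel phi ->
  charge_integral nu phi = \int[m1]_t phi t - \int[m2]_t phi t.
Proof.
move=> nuE bphi; rewrite /charge_integral.
pose p : finmeas R := jordan_pos (hahn_posnegP nu).
pose n : finmeas R := jordan_neg (hahn_posnegP nu).
change (\int[p]_t phi t - \int[n]_t phi t = \int[m1]_t phi t - \int[m2]_t phi t).
have intm m := bounded_borel_integrable m measurableT bphi.
have mphi : measurable_fun (setT : set (measurableTypeR R)) (fun t => (phi t)%:E).
  exact: measurable_int (intm p).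
have addE : (\int[measure_add p m2]_t (phi t)%:E =
             \int[measure_add m1 n]_t (phi t)%:E)%E.
  apply: eq_measure_integral => B mB _.
  transitivity (p B + m2 B)%E; first exact: measure_addE.
  transitivity (m1 B + n B)%E; last by rewrite -measure_addE.
  apply: fin_num_subeq; rewrite ?fin_num_measure//.
  rewrite -nuE// [RHS](jordan_decomp (hahn_posnegP nu) mB).
  by rewrite /cadd/= cscaleN1.
have finI m : (\int[m]_t (phi t)%:E \is a fin_num)%E.
  by apply: integrable_fin_num => //; exact: intm.
move: addE; rewrite !integral_measure_add//; [|exact: intm..].
rewrite /Rintegral -!fineB ?finI// => E; congr fine.
by apply: fin_num_addeq => //; rewrite ?finI.
Qed.

End charge_integral.

Section density.
Context {R : realType}.
Implicit Types (m : finmeas R).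

Lemma density_measure (g : R -> R) :
  lebesgue_measure.-integrable I01 (EFin \o g) -> (forall t, I01 t -> 0 <= g t) ->
  exists m : finmeas R, forall B : set (measurableTypeR R), measurable B ->
    m B = (\int[lebesgue_measure]_(t in B `&` I01) (g t)%:E)%E.
Proof.
move=> intg g0.
pose h : measurableTypeR R -> \bar R := (EFin \o g) \_ I01.
have inth : lebesgue_measure.-integrable setT h by apply/(integrable_mkcond _ _).1.
have h0 t : (0 <= h t)%E.
  by rewrite /h patchE; case: ifPn => // /set_mem /g0; rewrite lee_fin.
pose nu : signed_measure R := induced_charge inth.
have nu0 E : (0 <= nu E)%E by apply: integral_ge0 => t _; exact: h0.
pose m0 : {measure set (measurableTypeR R) -> \bar R} := measure_of_charge nu nu0.
have finm0 : fin_num_fun m0 by move=> U mU; exact: (fin_num_measure nu).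
pose m : finmeas R := HB.pack (m0 : set (measurableTypeR R) -> \bar R)
   (Measure.on m0) (Measure_isFinite.Build _ _ _ m0 finm0).
exists m => B mB; rewrite [LHS](_ : _ = \int[lebesgue_measure]_(t in B) h t)%E//.
by rewrite /h integral_mkcondr; apply: eq_integral => t _; rewrite restrict_EFin.
Qed.

(** By uniqueness of the density, the Radon-Nikodym derivative of [m] is [g] almost
    everywhere. *)
Lemma density_integral m (g phi : R -> R) :
  lebesgue_measure.-integrable I01 (EFin \o g) ->
  (forall B : set (measurableTypeR R), measurable B ->
    m B = (\int[lebesgue_measure]_(t in B `&` I01) (g t)%:E)%E) ->
  bounded_borel phi ->
  \int[m]_t phi t = \int[lebesgue_measure]_(t in I01) (phi t * g t).
Proof.
move=> intg mE bphi.
pose h : measurableTypeR R -> \bar R := (EFin \o g) \_ I01.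
have inth : lebesgue_measure.-integrable setT h by apply/(integrable_mkcond _ _).1.
have mh : measurable_fun setT h by exact: measurable_int inth.
have mE' B : measurable B -> m B = (\int[lebesgue_measure]_(t in B) h t)%E.
  move=> mB; rewrite mE// integral_mkcondr; apply: eq_integral => t _.
  by rewrite /h restrict_EFin.
have mleb : m `<< lebesgue_measure.
  apply/null_content_dominatesP => A mA A0; rewrite mE'//.
  by apply: null_set_integral => //; exact: measurable_funTS.
have intphi := bounded_borel_integrable m measurableT bphi.
rewrite /Rintegral -(Radon_Nikodym_change_of_variables mleb measurableT intphi).
have -> : (\int[lebesgue_measure]_(x in I01) (phi x * g x)%:E =
           \int[lebesgue_measure]_x ((phi x)%:E * h x))%E.
  rewrite integral_mkcond; apply: eq_integral => t _.
  by rewrite /h !patchE; case: ifPn => //; rewrite ?mule0 ?EFinM.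
have mphi : measurable_fun (setT : set (measurableTypeR R)) (fun t => (phi t)%:E).
  exact: measurable_int intphi.
have intRN := Radon_Nikodym_integrable (nu := charge_of_finite_measure m) mleb.
have aeh : ae_eq lebesgue_measure setT
    (Radon_Nikodym (charge_of_finite_measure m) lebesgue_measure) h.
  apply: integral_ae_eq => // E _ mE0.
  by rewrite -Radon_Nikodym_integral// -mE'.
congr fine; apply: ae_eq_integral => //; [exact: emeasurable_funM|exact: emeasurable_funM|].
exact: (ae_eqe_mul2l (EFin \o phi : measurableTypeR R -> \bar R) aeh).
Qed.

End density.

Lemma integrable_bounded_mul (R : realType)
    (mu : {measure set (measurableTypeR R) -> \bar R}) (D : set (measurableTypeR R))
    (phi h : R -> R) :
  measurable D -> bounded_borel phi -> mu.-integrable D (EFin \o h) ->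
  mu.-integrable D (EFin \o (fun t => phi t * h t)).
Proof.
move=> mD [mphi [M bM]] inth.
have mphiD : measurable_fun D phi by exact: measurable_funTS.
have bphi : [bounded phi x | x in D].
  exists M; split; first exact: num_real.
  by move=> x Mx t _ /=; rewrite (le_trans (bM t))// ltW.
by apply: eq_integrable (integrableMr mD mphiD bphi inth) => // t _ /=.
Qed.

Section determination.
Context {R : realType}.
Implicit Types (m : finmeas R).

Lemma signed_density (g : R -> R) :
  lebesgue_measure.-integrable I01 (EFin \o g) ->
  exists m1 m2 : finmeas R,
    (forall B : set (measurableTypeR R), measurable B ->
      \int[lebesgue_measure]_(t in B `&` I01) (g t)%:E = m1 B - m2 B)%E /\
    (forall phi, bounded_borel phi ->
      \int[lebesgue_measure]_(t in I01) (phi t * g t) =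
      \int[m1]_t phi t - \int[m2]_t phi t).
Proof.
move=> intg.
have intp : lebesgue_measure.-integrable I01 (EFin \o g^\+) by exact: integrable_funrpos.
have intn : lebesgue_measure.-integrable I01 (EFin \o g^\-) by exact: integrable_funrneg.
have gE t : g t = g^\+ t - g^\- t by rewrite -[in LHS](funrposBneg g).
have [m1 m1E] := density_measure intp (fun t _ => funrpos_ge0 g t).
have [m2 m2E] := density_measure intn (fun t _ => funrneg_ge0 g t).
exists m1, m2; split => [B mB|phi bphi].
  rewrite m1E// m2E// -integralB_EFin//; last 3 first.
  - exact: measurableI.
  - by apply: integrableS intp => //; exact: measurableI.
  - by apply: integrableS intn => //; exact: measurableI.
  by apply: eq_integral => t _; rewrite gE EFinB.
rewrite (density_integral intp m1E)// (density_integral intn m2E)//.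
rewrite -RintegralB//; [|exact: integrable_bounded_mul..].
by apply: eq_Rintegral => t _; rewrite [in LHS]gE mulrBr.
Qed.

(** The intervals [`]a, +oo[] form a pi-system that generates the Borel sets. *)
Lemma finmeas_eq_I01 m1 m2 :
  (forall a : R, 0 <= a -> m1 `]a, 1[ = m2 `]a, 1[) ->
  forall B : set (measurableTypeR R), measurable B -> m1 (B `&` I01) = m2 (B `&` I01).
Proof.
move=> m12 B mB.
pose mI := @measurable_I01 R.
have -> : m1 (B `&` I01) = mrestr m1 mI B by [].
have -> : m2 (B `&` I01) = mrestr m2 mI B by [].
apply: (@measure_unique _ R (measurableTypeR R) (@RGenOInfty.G R)
  (fun n => `]- n%:R, +oo[%classic) _ _ _ _ (mrestr m1 mI) (mrestr m2 mI)) => //.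
- exact: RGenOInfty.measurableE.
- move=> _ _ [x ->] [y ->]; exists (Num.max x y).
  apply/seteqP; split => z; rewrite /= !in_itv/= !andbT gt_max.
    by move=> [-> ->].
  by move=> /andP[-> ->].
- by move=> n; exists (- n%:R).
- apply/seteqP; split => // x _.
  have [n xn] : exists n, `|x| < n%:R by exists (Num.Def.archi_bound `|x|); exact: archi_boundP.
  exists n => //=; rewrite in_itv/= andbT.
  by rewrite ltrNl (le_lt_trans _ xn)// -normrN ler_norm.
- move=> _ [a ->]; rewrite /= /mrestr.
  have -> : `]a, +oo[%classic `&` I01 = `]Num.max a 0, 1[%classic :> set (measurableTypeR R).
    apply/seteqP; split => x; rewrite /I01 /= !in_itv/= gt_max andbT.
      by move=> [-> /andP[-> ->]].
    by move=> /andP[/andP[-> ->] ->].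
  by apply: m12; rewrite le_max lexx orbT.
- by move=> k; rewrite ltey_eq /= /mrestr fin_num_measure//; exact: measurableI.
Qed.

Lemma cvg_Rintegral_indic m (phi : (R -> R)^nat) (A : set R) :
  measurable (A : set (measurableTypeR R)) ->
  (forall n, bounded_borel (phi n)) -> (forall n t, 0 <= phi n t <= 1) ->
  (forall t, phi n t @[n --> \oo] --> (\1_A t : R)) ->
  (\int[m]_t phi n t) @[n --> \oo] --> fine (m A).
Proof.
move=> mA mphi phi01 phiA.
have intphi n := bounded_borel_integrable m measurableT (mphi n).
have [] := @dominated_convergence _ _ _ m setT measurableT
  (fun n => EFin \o phi n) (EFin \o \1_A) (cst 1%:E).
- by move=> n; exact: measurable_int (intphi n).
- by apply/measurable_EFinP; exact: measurable_indic.
- by apply: aeW => t _; apply: cvg_EFin; [exact: nearW|exact: phiA].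
- exact: finite_measure_integrable_cst.
- apply: aeW => t n _ /=; have /andP[p0 p1] := phi01 n t.
  by rewrite lee_fin ger0_norm.
move=> _ _; rewrite integral_indic// setIT => h.
apply: fine_cvg.
rewrite fineK ?fin_num_measure//.
Qed.

(** Dominated convergence turns equality of integrals along the approximations of
    the indicator functions into equality of the measures of the intervals [`]a, 1[]. *)
Lemma finmeas_eq_test m1 m2 :
  (forall a : R, 0 <= a -> exists phi : (R -> R)^nat,
     [/\ forall n, bounded_borel (phi n), forall n t, 0 <= phi n t <= 1,
       forall t, phi n t @[n --> \oo] --> (\1_(`]a, 1[%classic) t : R)
     & forall n, \int[m1]_t phi n t = \int[m2]_t phi n t]) ->
  forall B : set (measurableTypeR R), measurable B -> m1 (B `&` I01) = m2 (B `&` I01).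
Proof.
move=> H; apply: finmeas_eq_I01 => a a0.
have [phi [bphi phi01 phia eqphi]] := H a a0.
have mA : measurable (`]a, 1[%classic : set (measurableTypeR R)) by exact: measurable_itv.
have c1 := cvg_Rintegral_indic (m := m1) mA bphi phi01 phia.
have c2 := cvg_Rintegral_indic (m := m2) mA bphi phi01 phia.
have E : fine (m1 `]a, 1[%classic) = fine (m2 `]a, 1[%classic).
  move: c1; rewrite (funext eqphi) => c1.
  by rewrite -(cvg_lim (@Rhausdorff R) c1) (cvg_lim (@Rhausdorff R) c2).
by rewrite -(fineK (fin_num_measure m1 _ mA)) E fineK// fin_num_measure.
Qed.

End determination.

(** * The Lebesgue decomposition *)

Section lebesgue_decomposition.
Context {R : realType}.
Implicit Types (nu : signed_measure R).

(** The set [N] carries the part of [m] that is singular with respect to Lebesgue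
    measure.  It is a countable union of null sets whose measures under [m] approach
    the supremum over all null sets: a null set outside [N] of positive measure
    would exceed that supremum. *)
Lemma maximal_null_set (m : finmeas R) :
  exists N : set (measurableTypeR R),
    [/\ measurable N, lebesgue_measure N = 0%E
      & forall B : set (measurableTypeR R), measurable B ->
          lebesgue_measure B = 0%E -> m (B `\` N) = 0%E].
Proof.
pose T := measurableTypeR R.
pose null (A : set T) := measurable A /\ lebesgue_measure A = 0%E.
pose E : set R := [set fine (m A) | A in null].
have supE : has_sup E.
  split; first by exists (fine (m set0)), set0.
  exists (fine (m setT)) => _ [A [mA _] <-].
  apply: fine_le; rewrite ?fin_num_measure//.
  by apply: le_measure => //; rewrite inE.
have adh n : exists A, null A /\ sup E - n.+1%:R^-1 < fine (m A).
  have n0 : (0 : R) < n.+1%:R^-1 by rewrite invr_gt0.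
  by have [_ [A nA <-] ?] := sup_adherent n0 supE; exists A.
have [A_ A_P] := choice adh.
have mA_ n : measurable (A_ n) by have [[]] := A_P n.
pose N := \bigcup_n A_ n.
have mN : measurable N by exact: bigcupT_measurable.
have N0 : lebesgue_measure N = 0%E.
  apply/negligibleP => //; apply: negligible_bigcup => n; apply/negligibleP => //.
  by have [[]] := A_P n.
exists N; split => // B mB B0.
have mBN : measurable (B `\` N) by exact: measurableD.
have nBN : null (N `|` (B `\` N)).
  split; first exact: measurableU.
  rewrite null_set_setU//.
  apply/eqP; rewrite eq_le measure_ge0 andbT -B0; apply: le_measure; rewrite ?inE//.
have mU : m (N `|` (B `\` N)) = (m N + m (B `\` N))%E.
  by rewrite measureU// setDE setICA setICr setI0.
have ub : fine (m (N `|` (B `\` N))) <= sup E.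
  by apply: sup_upper_bound => //; exists (N `|` (B `\` N)).
have lb : sup E <= fine (m N).
  apply/ler_addgt0Pr => e e0.
  have [n ne] : exists n, n.+1%:R^-1 < e.
    exists (Num.Def.archi_bound e^-1).
    rewrite -[ltRHS]invrK ltf_pV2 ?posrE ?invr_gt0//.
    have := @archi_boundP R e^-1; rewrite invr_ge0 ltW// => /(_ isT) /lt_le_trans; apply.
    by rewrite ler_nat.
  have [_] := A_P n; rewrite ltrBlDr => /ltW/le_trans; apply.
  rewrite lerD ?(ltW ne)//; apply: fine_le; rewrite ?fin_num_measure//.
  by apply: le_measure; rewrite ?inE//; exact: bigcup_sup.
have le0 : fine (m (B `\` N)) <= 0.
  move: ub; rewrite mU fineD ?fin_num_measure// => ub.
  by rewrite -(lerD2l (fine (m N))) addr0 (le_trans ub lb).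
apply/eqP; rewrite eq_le measure_ge0 andbT.
by rewrite -(fineK (fin_num_measure m _ mBN)) lee_fin.
Qed.

(** The restriction of [nu] to a maximal null set of its total variation is the
    singular part; what remains is absolutely continuous, and its Radon-Nikodym
    density is [g]. *)
Lemma lebesgue_decomposition_exists nu : carried_by I01 nu ->
  exists p : (R -> R) * signed_measure R, is_lebesgue_decomposition nu p.1 p.2.
Proof.
move=> nuI.
pose V : finmeas R := HB.pack (charge_variation (hahn_posnegP nu)
      : set (measurableTypeR R) -> \bar R)
   (Measure.on (charge_variation (hahn_posnegP nu)))
   (Measure_isFinite.Build _ _ _ (charge_variation (hahn_posnegP nu)) (fin_num_measure _)).
have nuV B : measurable B -> (`|nu B| <= V B)%E by exact: abse_charge_variation.
have [N [mN N0 NP]] := maximal_null_set V.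
have mNC : measurable (~` N) by exact: measurableC.
pose nus : signed_measure R := crestr0 nu mN.
pose nua : signed_measure R := crestr0 nu mNC.
have nusE B : measurable B -> nus B = nu (B `&` N).
  by move=> mB; rewrite /nus /= /crestr0 mem_set.
have nuaE B : measurable B -> nua B = nu (B `\` N).
  by move=> mB; rewrite /nua /= /crestr0 mem_set// /crestr setDE.
have nuadom : nua `<< lebesgue_measure.
  apply/null_content_dominatesP => B mB B0; rewrite nuaE//.
  apply/eqP; rewrite -abse_eq0 eq_le abse_ge0 andbT -(NP _ mB B0).
  by apply: nuV; exact: measurableD.
have intf := Radon_Nikodym_integrable nuadom.
set f := Radon_Nikodym nua _ in intf.
have fE t : (fine (f t))%:E = f t by rewrite fineK// Radon_Nikodym_fin_num.
exists (fine \o f, nus); split => /=.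
- apply: eq_integrable (integrableS measurableT _ (@subsetT _ _) intf) => //.
  by move=> t _ /=; rewrite fE.
- exists N; split => // B mB BN; rewrite nusE// BN; exact: charge0.
- move=> B mB; under eq_integral do rewrite fE.
  have mBI : measurable (B `&` I01 : set (measurableTypeR R)) by exact: measurableI.
  rewrite -Radon_Nikodym_integral// nuaE// nusE// (chargeDI nu mB mN); congr (_ + _)%E.
  rewrite (chargeDI nu (measurableD mB mN) (@measurable_I01 R)).
  have -> : nu ((B `\` N) `\` I01) = 0%E.
    apply: nuI; first by apply: measurableD => //; exact: measurableD.
    by rewrite setDE -setIA setICl setI0.
  by rewrite add0e !setDE setIAC.
Qed.

End lebesgue_decomposition.

(** * A family of smooth functions *)

Section quadratic.
Context {R : realType}.

(** For the point where the two pieces of [flat] are glued: a bound on the function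
    replaces a computation of limits of difference quotients. *)
Lemma is_derive_quadratic (f : R -> R) (t g C : R) :
  (forall s, `|f s - f t - g * (s - t)| <= C * (s - t) ^+ 2) -> is_derive t 1 f g.
Proof.
move=> fC.
have lim_g : h^-1 *: (f (h *: 1 + t) - f t) @[h --> 0^'] --> g.
  apply/cvgrPdist_le => e e0.
  have C1 : 0 < `|C| + 1 by rewrite ltr_wpDl.
  near=> h.
  have h0 : h != 0 by near: h; exact: nbhs_dnbhs_neq.
  have he : `|h| <= e / (`|C| + 1).
    near: h; apply: cvg_within; near=> h.
    have : `|0 - h| < e / (`|C| + 1).
      by near: h; apply: (@cvgr_dist_lt _ _ _ _ _ id) => //; rewrite divr_gt0.
    by rewrite sub0r normrN => /ltW.
  have -> : g - h^-1 *: (f (h *: 1 + t) - f t) =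
      - (h^-1 * (f (h + t) - f t - g * h)).
    by rewrite /GRing.scale/= mulr1; field.
  rewrite normrN normrM normfV.
  have := fC (h + t); rewrite addrK => H.
  rewrite ler_pdivrMl ?normr_gt0// (le_trans H)//.
  rewrite -[h ^+ 2]ger0_norm ?sqr_ge0// normrX expr2 mulrA.
  rewrite (mulrC _ e) ler_wpM2r//.
  rewrite (@le_trans _ _ ((`|C| + 1) * `|h|))//.
    by rewrite ler_wpM2r// (le_trans (ler_norm C))// lerDl.
  by rewrite -ler_pdivlMl// mulrC.
split; first by apply/cvg_ex; exists g.
by rewrite /derive; apply: cvg_lim.
Unshelve. all: by end_near. Qed.

End quadratic.

Section smooth.
Context {R : realType}.
Implicit Types (f g : R -> R).

(** Smoothness is recorded by supplying the successive derivatives: stability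
    under sums and products is then an induction on [k], without computing iterated
    derivatives. *)
Fixpoint times_differentiable (k : nat) f : Prop :=
  if k is j.+1 then
    exists2 f' : R -> R, forall t : R, is_derive t 1 f (f' t) & times_differentiable j f'
  else True.

Local Notation Ck := times_differentiable.

Lemma Ck_pred k f : Ck k.+1 f -> Ck k f.
Proof. by elim: k f => // k IH f [f' ff' f'k]; exists f' => //; exact: IH. Qed.

Lemma CkD k f g : Ck k f -> Ck k g -> Ck k (fun t => f t + g t).
Proof.
elim: k f g => // k IH f g [f' ff' kf'] [g' gg' kg'].
exists (fun t => f' t + g' t); last exact: IH.
by move=> t; have := ff' t; have := gg' t => ? ?; exact: is_deriveD.
Qed.

Lemma CkZ k (c : R) f : Ck k f -> Ck k (fun t => c * f t).
Proof.
elim: k f => // k IH f [f' ff' kf'].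
exists (fun t => c * f' t); last exact: IH.
by move=> t; have := ff' t => ?; exact: is_deriveZ.
Qed.

Lemma CkM k f g : Ck k f -> Ck k g -> Ck k (fun t => f t * g t).
Proof.
elim: k f g => // k IH f g /[dup] kf [f' ff' kf'] /[dup] kg [g' gg' kg'].
exists (fun t => f t * g' t + g t * f' t).
  by move=> t; have := ff' t; have := gg' t => ? ?; exact: is_deriveM.
by apply: CkD; apply: IH => //; exact: Ck_pred.
Qed.

Lemma Ck_affine k (a b : R) f : Ck k f -> Ck k (fun t => f (a * t + b)).
Proof.
elim: k f => // k IH f [f' ff' kf'].
exists (fun t => a * f' (a * t + b)); last by apply: CkZ; exact: IH.
move=> t; have fa := ff' (a * t + b).
have aff : is_derive t 1 (fun s : R => a * s + b) a.
  have -> : (fun s : R => a * s + b) = (a *: id + cst b)%R by apply/funext.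
  by apply: is_derive_eq; rewrite addr0 /GRing.scale/= mulr1.
by rewrite mulrC; exact: is_derive1_comp.
Qed.

Lemma Ck_derivable f : (forall k, Ck k f) -> forall n t, derivable f^`(n) t 1.
Proof.
move=> fk n; have := fk n.+1; elim: n f {fk} => [|n IH] f [f' ff' kf'] t.
  by rewrite derive1n0; case: (ff' t).
rewrite derive1Sn; have -> : f^`()%classic = f'; last exact: IH.
by apply/funext => s; rewrite derive1E; case: (ff' s).
Qed.

(** The functions [x^-n exp (-1/x)] for [x > 0], extended by [0].  The family is
    closed under differentiation, up to linear combinations. *)
Definition flat (n : nat) (x : R) : R :=
  if 0 < x then x^-1 ^+ n * expR (- x^-1) else 0.

(** The exponential series bounds [y^(n+2) / (n+2)!] by [exp y]; the case [y = 1/x]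
    gives two powers of [x] to spare. *)
Lemma flat_quadratic n : exists C, forall x, `|flat n x| <= C * x ^+ 2.
Proof.
exists (n.+2)`!%:R => x; rewrite /flat; case: ifPn => x0; last first.
  by rewrite normr0 mulr_ge0// sqr_ge0.
rewrite ger0_norm ?mulr_ge0 ?exprn_ge0 ?invr_ge0 ?expR_ge0 ?(ltW x0)//.
have y0 : 0 < x^-1 by rewrite invr_gt0.
rewrite expRN ler_pdivrMr ?expR_gt0//.
have -> : x^-1 ^+ n = x ^+ 2 * x^-1 ^+ n.+2.
  by rewrite [x^-1 ^+ n.+2]exprS [x^-1 ^+ n.+1]exprS expr2; field; rewrite gt_eqF.
rewrite [leRHS](_ : _ = x ^+ 2 * (n.+2`!%:R * expR x^-1)); last by ring.
rewrite ler_wpM2l ?sqr_ge0//.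
have := @expR_ge1Dxn R x^-1 n.+1 (ltW y0).
move/(le_trans _) => /(_ (x^-1 ^+ n.+2 / n.+2`!%:R)).
rewrite lerDr ler01 => /(_ isT); rewrite ler_pdivrMr ?ltr0n ?fact_gt0//.
by rewrite mulrC.
Qed.

Lemma is_derive_flat (n : nat) (x : R) :
  is_derive x 1 (flat n) (flat n.+2 x - n%:R * flat n.+1 x).
Proof.
have [x0|x0|->] := ltgtP x 0.
- have -> : flat n.+2 x - n%:R * flat n.+1 x = 0.
    by rewrite /flat ltNge (ltW x0)/= mulr0 subr0.
  have c0 := is_derive_cst (0 : R) x (1 : R); apply: (near_eq_is_derive _ c0).
  near=> y; rewrite /flat ltNge; have /ltW -> // : y < 0.
  by near: y; exact: lt_nbhsl.
- have xn0 : x != 0 by rewrite gt_eqF.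
  have dV : is_derive x 1 (fun y : R => y^-1) (- x ^- 2).
    have := @is_deriveV R id x 1 1 xn0 (is_derive_id x 1).
    by rewrite /GRing.scale/= mulr1.
  have dX : is_derive x 1 (fun y : R => y^-1 ^+ n) (n%:R * x^-1 ^+ n.-1 * - x ^- 2).
    have -> : (fun y : R => y^-1 ^+ n) = (fun y : R => y^-1) ^+ n by rewrite exprfctE.
    exact: is_deriveX.
  have dE : is_derive x 1 (fun y : R => expR (- y^-1)) (expR (- x^-1) * - - x ^- 2).
    exact: (@is_derive1_comp _ expR (fun y : R => - y^-1)).
  pose f (y : R) := y^-1 ^+ n * expR (- y^-1).
  have dM : is_derive x 1 f (x^-1 ^+ n *: (expR (- x^-1) * - - x ^- 2) +
      expR (- x^-1) *: (n%:R * x^-1 ^+ n.-1 * - x ^- 2)).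
    exact: is_deriveM.
  have nearf : \near x, f x = flat n x.
    near=> y; rewrite /flat; have -> // : 0 < y.
    by near: y; exact: lt_nbhsr.
  apply: (is_derive_eq (near_eq_is_derive nearf dM)).
  rewrite /GRing.scale/= /flat x0.
  rewrite opprK exprVn.
  case: n {dX f dM nearf} => [|n].
    by rewrite !mul0r mulr0 addr0 subr0 expr0 invr1 mul1r exprVn mulrC.
  rewrite [n.+1.-1]/=.
  rewrite -[x ^- 2]exprVn -[x ^- n.+1]exprVn.
  by set y := x^-1; set e := expR _; rewrite !exprS expr0; ring.
- have -> : flat n.+2 0 - n%:R * flat n.+1 0 = 0.
    by rewrite /flat ltxx mulr0 subr0.
  have [C HC] := flat_quadratic n.
  apply: (@is_derive_quadratic _ _ _ _ C) => s; rewrite mul0r !subr0.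
  by rewrite [X in _ - X]/flat ltxx subr0.
Unshelve. all: by end_near. Qed.

Lemma Ck_flat k n : Ck k (flat n).
Proof.
elim: k n => // k IH n.
exists (fun x => flat n.+2 x + (- n%:R) * flat n.+1 x).
  by move=> t; apply: is_derive_eq; first exact: is_derive_flat; rewrite mulNr.
by apply: CkD => //; exact: CkZ.
Qed.

End smooth.

(** * Primitives of functions supported in the unit interval *)

Section primitive.
Context {R : realType}.
Implicit Types h : R -> R.

Lemma derivable_continuous (f : R -> R) :
  (forall t : R, derivable f t 1) -> continuous f.
Proof. by move=> df t; apply/differentiable_continuous/derivable1_diffP. Qed.

Lemma bounded_borel_continuous (f : R -> R) M :
  continuous f -> (forall t, `|f t| <= M) -> bounded_borel f.
Proof. by move=> cf fM; split; [exact: continuous_measurable_fun|exists M]. Qed.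

Lemma lebesgue_I01 : lebesgue_measure (I01 : set R) = 1%:E.
Proof. by rewrite /I01 lebesgue_measure_itv /= lte_fin ltr01 -EFinB subr0. Qed.

Lemma lebesgue_I01_lty : (lebesgue_measure (I01 : set R) < +oo)%E.
Proof. by rewrite lebesgue_I01 ltry. Qed.

Definition supported01 h := forall t, ~ I01 t -> h t = 0.

(** The primitive starts at [-oo], so that it is defined on the whole line, vanishes
    before [0] and is constant after [1] when [h] is supported in the interval. *)
Definition primitive h (t : R) : R := \int[lebesgue_measure]_(s in `]-oo, t]) h s.

Lemma integrable_supported h (D : set (measurableTypeR R)) : measurable D ->
  lebesgue_measure.-integrable I01 (EFin \o h) -> supported01 h ->
  lebesgue_measure.-integrable D (EFin \o h).
Proof.
move=> mD inth h0; apply: (integrableS measurableT) => //.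
have intT : lebesgue_measure.-integrable setT ((EFin \o h) \_ I01).
  by apply/(integrable_mkcond _ _).1.
apply: eq_integrable intT => // t _; rewrite patchE.
by case: ifPn => // /negP; rewrite inE => /h0 /= ->.
Qed.

Lemma bounded_borel_integrable01 h :
  bounded_borel h -> lebesgue_measure.-integrable I01 (EFin \o h).
Proof.
move=> [mh [M hM]]; apply: measurable_bounded_integrable => //.
- exact: lebesgue_I01_lty.
- exact: measurable_funTS.
- exists M; split; first exact: num_real.
  by move=> x Mx t _ /=; rewrite (le_trans (hM t))// ltW.
Qed.

Lemma primitive_le0 h t : supported01 h -> t <= 0 -> primitive h t = 0.
Proof.
move=> h0 t0; rewrite /primitive -(Rintegral_set0 lebesgue_measure h).
rewrite [RHS](_ : _ = \int[lebesgue_measure]_(s in `]-oo, t]) (cst 0 s)); last first.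
  by rewrite Rintegral_set0 Rintegral_cst// mul0r.
apply: eq_Rintegral => s; rewrite inE/= in_itv/= => st; apply: h0.
by rewrite /I01 /= in_itv/= ltNge (le_trans st t0).
Qed.

Lemma primitive_ge1 h t : supported01 h -> 1 <= t ->
  primitive h t = \int[lebesgue_measure]_(s in I01) h s.
Proof.
move=> h0 t1; rewrite /primitive Rintegral_mkcond [RHS]Rintegral_mkcond.
apply: eq_Rintegral => s _; rewrite !patchE.
have [s01|s01] := pselect (I01 s); last first.
  by rewrite [in RHS]memNset//; case: ifP => // _; exact: h0.
rewrite [in RHS]mem_set// mem_set//= in_itv/=.
by move: s01; rewrite /I01 /= in_itv/= => /andP[_ /ltW s1]; exact: le_trans t1.
Qed.

Lemma primitive_increment h s t : supported01 h ->
  lebesgue_measure.-integrable I01 (EFin \o h) -> s <= t ->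
  primitive h t - primitive h s = \int[lebesgue_measure]_(r in `]s, t]) h r.
Proof.
move=> h0 inth st; rewrite /primitive Rintegral_itvB// ?bnd_simp//.
exact: integrable_supported.
Qed.

Lemma lebesgue_itvoc (s t : R) : s <= t ->
  lebesgue_measure (`]s, t]%classic : set R) = (t - s)%:E.
Proof.
move=> st; rewrite lebesgue_measure_itv /= lte_fin.
case: ltP => ts //; congr (_%:E).
by apply/eqP; rewrite eq_sym subr_eq0 eq_le ts st.
Qed.

Lemma cst_integrable_itv (s t M : R) : s <= t ->
  lebesgue_measure.-integrable (`]s, t] : set (measurableTypeR R)) (EFin \o cst M).
Proof.
move=> st; apply: measurable_bounded_integrable => //.
- have lt : (lebesgue_measure (`]s, t]%classic : set R) < +oo)%E.
    by rewrite lebesgue_itvoc// ltry.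
  exact: lt.
- exists `|M|; split; first exact: num_real.
  by move=> x Mx r _ /=; rewrite ltW.
Qed.

Lemma primitive_le h s t M : supported01 h ->
  lebesgue_measure.-integrable I01 (EFin \o h) -> s <= t ->
  (forall r, s < r <= t -> h r <= M) -> primitive h t - primitive h s <= M * (t - s).
Proof.
move=> h0 inth st hM; rewrite primitive_increment//.
rewrite (_ : t - s = fine (lebesgue_measure (`]s, t]%classic : set R))); last first.
  by rewrite lebesgue_itvoc.
rewrite -Rintegral_cst//; apply: le_Rintegral => //.
- exact: integrable_supported.
- exact: cst_integrable_itv.
Qed.

Lemma primitive_ge h s t M : supported01 h ->
  lebesgue_measure.-integrable I01 (EFin \o h) -> s <= t ->
  (forall r, s < r <= t -> M <= h r) -> M * (t - s) <= primitive h t - primitive h s.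
Proof.
move=> h0 inth st hM; rewrite primitive_increment//.
rewrite (_ : t - s = fine (lebesgue_measure (`]s, t]%classic : set R))); last first.
  by rewrite lebesgue_itvoc.
rewrite -Rintegral_cst//; apply: le_Rintegral => //.
- exact: cst_integrable_itv.
- exact: integrable_supported.
Qed.

Lemma is_derive_primitive h t : supported01 h ->
  lebesgue_measure.-integrable I01 (EFin \o h) -> {for t, continuous h} ->
  is_derive t 1 (primitive h) (h t).
Proof.
move=> h0 inth ch.
have t1 : t < t + 1 by rewrite ltrDl.
have inth' : lebesgue_measure.-integrable `]-oo, t + 1] (EFin \o h).
  exact: integrable_supported.
have /(_ _ ch)[|dF F'] := @continuous_FTC1 R h -oo%O t (t + 1) t1 inth'.
  exact: ltNyr.
by split; [exact: dF|rewrite -F' derive1E].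
Qed.

End primitive.

(** * Test functions *)

Section test_functions.
Context {R : realType}.
Implicit Types phi : R -> R.

(** Smooth functions supported in [[a, b]], a closed condition that is stable under
    linear combinations and easy to enlarge. *)
Definition smooth_on (a b : R) phi :=
  (forall k, times_differentiable k phi) /\
  (forall t, ~~ (a <= t <= b) -> phi t = 0).

Lemma test_fun_smooth_on a b phi : 0 < a -> b < 1 -> smooth_on a b phi -> test_fun phi.
Proof.
move=> a0 b1 [kphi phi0].
have supp : closure [set t | phi t != 0] `<=` `[a, b].
  have /closure_id -> : closed (`[a, b]%classic : set R) by exact: interval_closed.
  apply: closure_subset => t /=; rewrite in_itv/=.
  by apply: contraNT => /phi0 /eqP.
split.
- exact: Ck_derivable.
- apply: (subclosed_compact _ _ supp); first exact: closed_closure.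
  exact: segment_compact.
- move=> t /supp; rewrite /I01 /= !in_itv/= => /andP[at_ tb].
  by rewrite (lt_le_trans a0)// (le_lt_trans tb).
Qed.

Lemma test_fun_supported phi : test_fun phi -> supported01 phi.
Proof.
move=> [_ _ s01] t nt; apply/eqP/negPn/negP => pt; apply: nt; apply: s01.
exact: subset_closure.
Qed.

Lemma test_fun_continuous phi : test_fun phi -> continuous phi.
Proof. by move=> [d _ _]; apply: derivable_continuous => t; exact: (d 0%N). Qed.

Lemma supported_bounded_borel phi : continuous phi -> supported01 phi -> bounded_borel phi.
Proof.
move=> cphi phi0.
have cn : {within `[0, 1], continuous (fun t : R => `|phi t|)}.
  apply: continuous_subspaceT => t.
  by apply: continuous_comp; [exact: cphi|exact: norm_continuous].
have [c _ cM] := EVT_max (@ler01 R) cn.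
apply: (@bounded_borel_continuous _ _ `|phi c|) => // t.
have [t01|/phi0 ->] := pselect (I01 t); last by rewrite normr0.
by apply: cM; move: t01; rewrite /I01 /= !in_itv/= => /andP[/ltW -> /ltW ->].
Qed.

Lemma test_fun_bounded_borel phi : test_fun phi -> bounded_borel phi.
Proof.
move=> tphi; apply: supported_bounded_borel; first exact: test_fun_continuous.
exact: test_fun_supported.
Qed.

Lemma flat0_bound (x : R) : 0 <= flat 0 x <= 1.
Proof.
rewrite /flat; case: ifPn => x0; last by rewrite lexx ler01.
rewrite expr0 mul1r expR_ge0/= -expR0 ler_expR oppr_le0 invr_ge0; exact: ltW.
Qed.

Lemma flat0_cvg (c : R) : 0 < c -> flat 0 (n.+1%:R * c + - 1) @[n --> \oo] --> (1 : R).
Proof.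
move=> c0; apply/cvgrPdist_le => e e0; near=> n.
have en : e^-1 <= n.+1%:R * c + - 1.
  rewrite lerBrDr -ler_pdivrMr//.
  apply: (@le_trans _ _ n%:R); last by rewrite ler_nat.
  by near: n; exact: nbhs_infty_ger.
have x0 : 0 < n.+1%:R * c + - 1 by rewrite (lt_le_trans _ en)// invr_gt0.
have /andP[_ f1] := flat0_bound (n.+1%:R * c + - 1).
rewrite ger0_norm ?subr_ge0// /flat x0 expr0 mul1r lerBlDr addrC -lerBlDr.
apply: le_trans (expR_ge1Dx _); rewrite lerB//.
by rewrite -[leRHS]invrK lef_pV2// ?posrE// invr_gt0.
Unshelve. all: by end_near. Qed.

(** With [c = n + 1], this is [flat 0 (c (t - a) - 1) * flat 0 (c (1 - t) - 1)]: it
    vanishes outside [[a + 1/c, 1 - 1/c]] and tends to the indicator function of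
    [`]a, 1[], as [flat 0] is [0] on the negative axis and tends to [1] at infinity.
    The arguments are in affine form for [Ck_affine]. *)
Definition ray_bump (a : R) (n : nat) (t : R) : R :=
  flat 0 (n.+1%:R * t + (- (n.+1%:R * a) + - 1)) *
  flat 0 (- n.+1%:R * t + (n.+1%:R + - 1)).

Lemma ray_bumpE a n t : ray_bump a n t =
  flat 0 (n.+1%:R * (t - a) + - 1) * flat 0 (n.+1%:R * (1 - t) + - 1).
Proof. by rewrite /ray_bump; congr (flat 0 _ * flat 0 _); ring. Qed.

Lemma flat_le0 (k : nat) (x : R) : x <= 0 -> flat k x = 0.
Proof. by move=> x0; rewrite /flat ltNge x0. Qed.

Lemma ray_bump_smooth a n :
  smooth_on (a + n.+1%:R^-1) (1 - n.+1%:R^-1) (ray_bump a n).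
Proof.
have n0 : (0 : R) < n.+1%:R by [].
split=> [k|t].
  by apply: CkM; apply: Ck_affine; exact: Ck_flat.
rewrite negb_and -!ltNge ray_bumpE => /orP[] H.
  rewrite flat_le0 ?mul0r// subr_le0 mulrC -ler_pdivlMr// mul1r.
  by rewrite lerBlDr addrC ltW.
rewrite [X in _ * X]flat_le0 ?mulr0// subr_le0 mulrC -ler_pdivlMr// mul1r.
by rewrite lerBlDr addrC -lerBlDr ltW.
Qed.

Lemma ray_bump_bound a n t : 0 <= ray_bump a n t <= 1.
Proof.
have /andP[p0 p1] := flat0_bound (n.+1%:R * (t - a) + - 1).
have /andP[q0 q1] := flat0_bound (n.+1%:R * (1 - t) + - 1).
by rewrite ray_bumpE mulr_ge0//= mulr_ile1.
Qed.

Lemma ray_bump_test a n : 0 <= a -> test_fun (ray_bump a n).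
Proof.
move=> a0; apply: test_fun_smooth_on (ray_bump_smooth a n).
  by rewrite ltr_wpDl.
by rewrite ltrBlDr ltrDl.
Qed.

Lemma ray_bump_cvg a t : ray_bump a n t @[n --> \oo] --> (\1_(`]a, 1[%classic) t : R).
Proof.
rewrite indicE; have [|] := boolP (t \in `]a, 1[%classic).
  rewrite inE /= in_itv/= => /andP[ta t1].
  have -> : (true%:R : R) = 1 * 1 by rewrite mulr1.
  rewrite (_ : (fun n => ray_bump a n t) = (fun n =>
    flat 0 (n.+1%:R * (t - a) + - 1) * flat 0 (n.+1%:R * (1 - t) + - 1))); last first.
    by apply/funext => n; rewrite ray_bumpE.
  by apply: cvgM; apply: flat0_cvg; rewrite subr_gt0.
move=> /negP; rewrite inE /= in_itv/= => nt.
rewrite (_ : (fun n => ray_bump a n t) = cst 0); first exact: cvg_cst.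
apply/funext => n; rewrite ray_bumpE /=.
have [ta|ta] := leP t a.
  rewrite flat_le0 ?mul0r// (@le_trans _ _ (n.+1%:R * (t - a)))//.
    by rewrite gerDl lerN10.
  by rewrite mulr_ge0_le0// subr_le0.
have [t1|t1] := leP 1 t; last by case: nt; rewrite ta t1.
rewrite [X in _ * X]flat_le0 ?mulr0// (@le_trans _ _ (n.+1%:R * (1 - t)))//.
  by rewrite gerDl lerN10.
by rewrite mulr_ge0_le0// subr_le0.
Qed.

(** The bumps [ray_bump a n] are test functions that converge to the indicator
    function of [`]a, 1[]. *)
Lemma finmeas_eq_test_fun (m1 m2 : finmeas R) :
  (forall phi, test_fun phi -> \int[m1]_t phi t = \int[m2]_t phi t) ->
  forall B : set (measurableTypeR R), measurable B -> m1 (B `&` I01) = m2 (B `&` I01).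
Proof.
move=> H; apply: finmeas_eq_test => a a0; exists (ray_bump a); split.
- by move=> n; apply: test_fun_bounded_borel; exact: ray_bump_test.
- exact: ray_bump_bound.
- exact: ray_bump_cvg.
- by move=> n; apply: H; exact: ray_bump_test.
Qed.

End test_functions.

(** * Integration by parts for functions of bounded variation *)

Section fubini_primitive.
Context {R : realType}.
Implicit Types (m : finmeas R) (h : R -> R).

Definition upper_tail m (s : R) : R := fine (m `[s, +oo[%classic).

Lemma upper_tail_bounded_borel m : bounded_borel (upper_tail m).
Proof.
have mray s : measurable (`[s, +oo[%classic : set (measurableTypeR R)).
  exact: measurable_itv.
split.
  apply: nonincreasing_measurable => // s t st.
  apply: fine_le; rewrite ?fin_num_measure//.
  apply: le_measure; rewrite ?inE//.
  by move=> x /=; rewrite !in_itv/= !andbT; exact: le_trans.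
exists (fine (m setT)) => s; rewrite ger0_norm ?fine_ge0//.
apply: fine_le; rewrite ?fin_num_measure//.
by apply: le_measure; rewrite ?inE.
Qed.

(** Fubini for the integrand [h s] on the half-plane [s <= t], which is integrable
    for the product of [m] and Lebesgue measure because [m] is finite. *)
Lemma integral_primitive m h : bounded_borel h -> supported01 h ->
  \int[m]_t primitive h t =
  \int[lebesgue_measure]_(s in I01) (h s * upper_tail m s).
Proof.
move=> bh h0; have inth := bounded_borel_integrable01 bh.
have [mh [M hM]] := bh.
pose T := measurableTypeR R.
pose k (x : T * T) : R := h x.2 * \1_(`[0, +oo[%classic) (x.1 - x.2).
pose f (x : T * T) : \bar R := (k x)%:E.
have mk : measurable_fun setT k.
  apply: measurable_funM; first by apply: measurableT_comp => //; exact: measurable_snd.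
  apply: measurableT_comp => //.
  by apply: measurable_funB; [exact: measurable_fst|exact: measurable_snd].
have mf : measurable_fun setT f by apply/measurable_EFinP.
have kE (t s : R) : k (t, s) = h s * \1_(`]-oo, t]%classic) s.
  rewrite /k /= !indicE; congr (_ * (nat_of_bool _)%:R).
  by apply/idP/idP; rewrite !inE/= !in_itv/= ?andbT subr_ge0.
have inner1 (t : R) : (\int[lebesgue_measure]_s f (t, s) = (primitive h t)%:E)%E.
  rewrite /primitive /Rintegral fineK; last first.
    by apply: integrable_fin_num => //; exact: integrable_supported.
  rewrite [RHS]integral_mkcond; apply: eq_integral => s _.
  by rewrite /f kE indicE patchE; case: ifP => _; rewrite ?mulr1 ?mulr0.
have inner2 (s : R) : (\int[m]_t f (t, s) = (h s * upper_tail m s)%:E)%E.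
  rewrite [LHS](_ : _ = (\int[m]_t ((h s)%:E * (\1_(`[s, +oo[%classic) t)%:E)))%E; last first.
    apply: eq_integral => t _; rewrite /f kE -EFinM !indicE; congr (_ * (nat_of_bool _)%:R)%:E.
    by apply/idP/idP; rewrite !inE/= !in_itv/= ?andbT.
  have mray : measurable (`[s, +oo[%classic : set T) by exact: measurable_itv.
  rewrite integralZl//; last exact: integrable_indic.
  by rewrite integral_indic// setIT EFinM /upper_tail fineK// fin_num_measure.
have intf : ((m \x lebesgue_measure)%E).-integrable setT f.
  apply/(integrable12ltyP m lebesgue_measure mf).
  pose C := fine (\int[lebesgue_measure]_(s in I01) `|(h s)%:E|)%E.
  have CE : (\int[lebesgue_measure]_(s in I01) `|(h s)%:E| = C%:E)%E.
    by rewrite fineK//; apply: integrable_fin_num => //; exact: integrable_abse.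
  apply: (@le_lt_trans _ _ (\int[m]_t (cst C%:E t)))%E; last first.
    by apply: integrable_lty => //; exact: finite_measure_integrable_cst.
  apply: ge0_le_integral => //.
  - by move=> t _; apply: integral_ge0.
  - have mabs : measurable_fun setT (abse \o f) by exact: measurableT_comp.
    exact: (measurable_fun_fubini_tonelli_F (m2 := lebesgue_measure) (abse \o f) mabs
      (fun x => abse_ge0 (f x))).
  - move=> t _ /=; rewrite -CE [leRHS]integral_mkcond; apply: ge0_le_integral => //.
    have mabst : measurable_fun setT (fun s => `|f (t, s)|%E).
      apply: measurableT_comp => //; apply/measurable_EFinP.
      apply: (measurableT_comp mk); exact: measurable_pair1.
    + exact: mabst.
    + have intT : lebesgue_measure.-integrable setT ((abse \o (EFin \o h)) \_ I01).
        by apply/(integrable_mkcond _ _).1 => //; exact: integrable_abse.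
      exact: measurable_int intT.
    + move=> s _; rewrite patchE -/(k (t, s)) kE normrM indicE.
      case: ifPn => [_|/negP]; last by rewrite inE => /h0 ->; rewrite normr0 mul0r.
      by rewrite lee_fin ler_piMr//; case: (_ \in _); rewrite ?normr1 ?normr0.
have FE := Fubini intf.
have FL : (\int[m]_t \int[lebesgue_measure]_s f (t, s) = \int[m]_t (primitive h t)%:E)%E.
  by apply: eq_integral => t _; exact: inner1.
have FR : (\int[lebesgue_measure]_s \int[m]_t f (t, s) =
           \int[lebesgue_measure]_s (h s * upper_tail m s)%:E)%E.
  by apply: eq_integral => s _; exact: inner2.
rewrite /Rintegral -FL FE FR [in RHS]integral_mkcond; congr fine.
apply: eq_integral => s _; rewrite patchE; case: ifPn => // /negP.
by rewrite inE => /h0 ->; rewrite mul0r.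
Qed.

End fubini_primitive.

Section du_bois_reymond.
Context {R : realType}.
Implicit Types (h k : R -> R).

Lemma smooth_on_sub (a b a' b' : R) (psi : R -> R) :
  a' <= a -> b <= b' -> smooth_on a b psi -> smooth_on a' b' psi.
Proof.
move=> aa bb [kpsi psi0]; split => // t; rewrite negb_and -!ltNge => ht.
apply: psi0; rewrite negb_and -!ltNge.
case/orP: ht => ht; first by rewrite (lt_le_trans ht).
by rewrite (le_lt_trans bb) ?orbT.
Qed.

Lemma smooth_on_comb (a b c : R) (psi theta : R -> R) :
  smooth_on a b psi -> smooth_on a b theta ->
  smooth_on a b (fun t => psi t + c * theta t).
Proof.
move=> [kpsi psi0] [kth th0]; split => [n|t ht].
  by apply: CkD => //; exact: CkZ.
by rewrite psi0// th0// mulr0 addr0.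
Qed.

(** The mean value zero makes the primitive vanish again after the support of
    [psi], so it is itself a test function. *)
Lemma primitive_smooth_on (a b : R) (psi : R -> R) : 0 < a -> b < 1 ->
  smooth_on a b psi -> \int[lebesgue_measure]_(t in I01) psi t = 0 ->
  smooth_on a b (primitive psi) /\ (primitive psi)^`()%classic = psi.
Proof.
move=> a0 b1 /[dup] spsi [kpsi psi0] int0.
have tpsi := test_fun_smooth_on a0 b1 spsi.
have s01 := test_fun_supported tpsi.
have inth := bounded_borel_integrable01 (test_fun_bounded_borel tpsi).
have dprim (t : R) : is_derive t 1 (primitive psi) (psi t).
  by apply: is_derive_primitive => //; exact: test_fun_continuous tpsi t.
split; last by apply/funext => t; rewrite derive1E; case: (dprim t).
have const s t : s <= t -> (forall r, s < r <= t -> psi r = 0) ->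
    primitive psi t = primitive psi s.
  move=> st psist; apply/eqP; rewrite -subr_eq0 eq_le.
  have := @primitive_le _ _ _ _ 0 s01 inth st; rewrite mul0r => -> /=; last first.
    by move=> r /psist ->.
  have := @primitive_ge _ _ _ _ 0 s01 inth st; rewrite mul0r => -> //.
  by move=> r /psist ->.
split=> [n|t].
  apply: (@Ck_pred _ n); exists psi => //; exact: kpsi.
rewrite negb_and -!ltNge => /orP[ta|bt].
  rewrite (const (Num.min t 0)) ?ge_min ?lexx//.
    by apply: primitive_le0 => //; rewrite ge_min lexx orbT.
  move=> r /andP[_ rt]; apply: psi0; rewrite negb_and -!ltNge.
  by rewrite (le_lt_trans rt ta).
rewrite -(const t (Num.max t 1)) ?le_max ?lexx//.
  by rewrite primitive_ge1// le_max lexx orbT.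
move=> r /andP[tr _]; apply: psi0; rewrite negb_and -!ltNge.
by rewrite (lt_trans bt tr) orbT.
Qed.

Lemma ray_bump_integral_gt0 : exists n,
  0 < \int[lebesgue_measure]_(t in I01) (ray_bump 0 n t : R).
Proof.
have int1 : lebesgue_measure.-integrable I01 (EFin \o (cst 1 : R -> R)).
  by apply: bounded_borel_integrable01; apply: (@bounded_borel_continuous _ _ 1) => [|t];
    [exact: cst_continuous|rewrite normr1].
have [m mE] := density_measure int1 (fun t _ => @ler01 R).
have mA : measurable (`]0, 1[%classic : set (measurableTypeR R)) by exact: measurable_itv.
have bb n := test_fun_bounded_borel (ray_bump_test n (lexx (0 : R))).
have cv := cvg_Rintegral_indic (m := m) mA bb (ray_bump_bound 0) (@ray_bump_cvg R 0).
have m1 : fine (m `]0, 1[%classic) = 1.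
  rewrite mE// setIid.
  transitivity (\int[lebesgue_measure]_(t in I01) (1 : R)) => //.
  rewrite Rintegral_cst// mul1r.
  transitivity (fine (lebesgue_measure (I01 : set R))) => //.
  by rewrite lebesgue_I01.
rewrite m1 in cv.
have [n _ nP] := @cvgr_gt _ _ _ _ _ _ cv _ (ltr01 : (0 : R) < 1).
exists n; have := nP n (leqnn n); rewrite (density_integral int1 mE)//=.
by under eq_Rintegral do rewrite mulr1.
Qed.

(** A function orthogonal to all derivatives of test functions is constant.  The
    derivatives of test functions are the test functions of mean zero; subtracting a
    multiple of a fixed bump [theta] brings any test function to mean zero, so
    [k - c], where [c] is the [theta]-average of [k], is orthogonal to all of them. *)
Lemma du_bois_reymond k :
  lebesgue_measure.-integrable I01 (EFin \o k) ->
  (forall a b psi, 0 < a -> b < 1 -> smooth_on a b psi ->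
     \int[lebesgue_measure]_(t in I01) psi t = 0 ->
     \int[lebesgue_measure]_(t in I01) (psi t * k t) = 0) ->
  exists c, ae_eq lebesgue_measure I01 k (cst c).
Proof.
move=> intk H.
have [n n0] := ray_bump_integral_gt0.
(* [theta] normalizes: its integral [I] is nonzero *)
set theta := ray_bump 0 n in n0; set I := \int[_]_(t in _) _ in n0.
have sth := ray_bump_smooth (0 : R) n; rewrite -/theta in sth.
pose c := \int[lebesgue_measure]_(t in I01) (theta t * k t) / I.
exists c.
have tth : test_fun theta by exact: ray_bump_test.
have bth := test_fun_bounded_borel tth.
have intc : lebesgue_measure.-integrable I01 (EFin \o (cst c : R -> R)).
  by apply: bounded_borel_integrable01; apply: (@bounded_borel_continuous _ _ `|c|);
    [exact: cst_continuous|].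
pose g t := k t - c.
have intg : lebesgue_measure.-integrable I01 (EFin \o g).
  by apply: eq_integrable (integrableB _ intk intc) => //.
have [m1 [m2 [mE mint]]] := signed_density intg.
have m12 B : measurable B -> m1 (B `&` I01) = m2 (B `&` I01).
  apply: finmeas_eq_test => a a0; exists (ray_bump a).
  have bb i := test_fun_bounded_borel (ray_bump_test i a0).
  split => //; [exact: ray_bump_bound|exact: ray_bump_cvg|move=> i].
  apply/eqP; rewrite -subr_eq0 -mint//; apply/eqP.
  set psi := ray_bump a i.
  pose J := \int[lebesgue_measure]_(t in I01) psi t.
  have ipsi := bounded_borel_integrable01 (bb i).
  have ith := bounded_borel_integrable01 bth.
  have ithJ : lebesgue_measure.-integrable I01 (EFin \o (fun t => (- (J / I)) * theta t)).
    by apply: eq_integrable (integrableZl _ (- (J / I)) ith).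
  have ipsik := integrable_bounded_mul (@measurable_I01 R) (bb i) intk.
  have ithk := integrable_bounded_mul (@measurable_I01 R) bth intk.
  have ithkJ : lebesgue_measure.-integrable I01
      (EFin \o (fun t => (- (J / I)) * (theta t * k t))).
    by apply: eq_integrable (integrableZl _ (- (J / I)) ithk).
  have /H : 0 < Num.min (a + i.+1%:R^-1) (0 + n.+1%:R^-1).
    by rewrite lt_min !ltr_wpDl.
  move=> /(_ (Num.max (1 - i.+1%:R^-1) (1 - n.+1%:R^-1))
     (fun t => psi t + (- (J / I)) * theta t)).
  rewrite gt_max !ltrBlDr !ltrDl !invr_gt0 !ltr0n => /(_ isT) H1.
  have : \int[lebesgue_measure]_(t in I01) ((psi t + - (J / I) * theta t) * k t) = 0.
    apply: H1.
      apply: smooth_on_comb.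
        by apply: smooth_on_sub (ray_bump_smooth a i); rewrite ?ge_min ?le_max lexx.
      by apply: smooth_on_sub sth; rewrite ?ge_min ?le_max lexx orbT.
    rewrite RintegralD// RintegralZl// -/J -/I mulNr divfK ?subrr//.
    by rewrite gt_eqF.
  rewrite (@eq_Rintegral _ _ _ _ _
    (fun t : measurableTypeR R => psi t * k t + - (J / I) * (theta t * k t))); last first.
    by move=> t _; ring.
  rewrite RintegralD// RintegralZl// => E.
  rewrite (@eq_Rintegral _ _ _ _ _ (fun t : measurableTypeR R => psi t * k t - psi t * c)); last first.
    by move=> t _; rewrite /g; ring.
  have ipsic : lebesgue_measure.-integrable I01 (EFin \o (fun t => psi t * c)).
    exact: (integrable_bounded_mul (@measurable_I01 R) (bb i) intc).
  rewrite RintegralB// RintegralZr// -/J.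
  move/eqP: E; rewrite mulNr subr_eq0 => /eqP ->; rewrite /c.
  by rewrite mulrA mulrAC subrr.
suff : ae_eq lebesgue_measure I01 (EFin \o k) (EFin \o (cst c : R -> R)).
  by apply: filterS => t /= kt /kt [].
apply: integral_ae_eq => //; first exact: measurable_int intc.
move=> E EI mE0.
have E0 : (\int[lebesgue_measure]_(t in E) (g t)%:E = 0)%E.
  have EE : E = E `&` I01 by rewrite setIidl.
  rewrite -(setIidl EI) mE// -{1 2}(setIidl EI) m12// subee// fin_num_measure//.
  exact: measurableI.
have intkE := integrableS (@measurable_I01 R) mE0 EI intk.
have intcE := integrableS (@measurable_I01 R) mE0 EI intc.
have : (\int[lebesgue_measure]_(t in E) (k t)%:E -
        \int[lebesgue_measure]_(t in E) (cst c t)%:E = 0)%E.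
  by rewrite -integralB_EFin.
by apply: fin_num_sub0_eq; exact: integrable_fin_num.
Qed.

End du_bois_reymond.

Section by_parts.
Context {R : realType}.
Implicit Types (h w : R -> R) (nu : signed_measure R).

(** The definition of the distributional derivative, extended from test functions to
    the primitives of bounded functions of mean zero.  By [integral_primitive] the
    right-hand side is minus the integral of [h] against the tail of [nu], and by
    [du_bois_reymond] the sum of [w] and this tail is constant almost everywhere;
    a constant is orthogonal to [h]. *)
Lemma BV_by_parts w nu h :
  lebesgue_measure.-integrable I01 (EFin \o w) -> is_distr_derivative w nu ->
  bounded_borel h -> supported01 h -> \int[lebesgue_measure]_(t in I01) h t = 0 ->
  \int[lebesgue_measure]_(t in I01) (h t * w t) = - charge_integral nu (primitive h).
Proof.
move=> intw [_ nuw].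
pose p : finmeas R := jordan_pos (hahn_posnegP nu).
pose n : finmeas R := jordan_neg (hahn_posnegP nu).
pose tail s := upper_tail p s - upper_tail n s.
have btail : bounded_borel tail.
  have [mp [P hP]] := upper_tail_bounded_borel p.
  have [mn [N hN]] := upper_tail_bounded_borel n.
  split; first exact: measurable_funB.
  by exists (P + N) => s; rewrite (le_trans (ler_normB _ _))// lerD.
have inttail := bounded_borel_integrable01 btail.
have tailE h' : bounded_borel h' -> supported01 h' ->
    charge_integral nu (primitive h') =
    \int[lebesgue_measure]_(t in I01) (h' t * tail t).
  move=> bh h0; rewrite /charge_integral.
  change (\int[p]_t primitive h' t - \int[n]_t primitive h' t =
          \int[lebesgue_measure]_(t in I01) (h' t * tail t)).
  rewrite !integral_primitive// -RintegralB//.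
  - by apply: eq_Rintegral => s _; rewrite mulrBr.
  - apply: integrable_bounded_mul => //; apply: bounded_borel_integrable01.
    exact: upper_tail_bounded_borel.
  - apply: integrable_bounded_mul => //; apply: bounded_borel_integrable01.
    exact: upper_tail_bounded_borel.
pose k t := w t + tail t.
have intk : lebesgue_measure.-integrable I01 (EFin \o k).
  by apply: eq_integrable (integrableD _ intw inttail).
have [c kc] : exists c, ae_eq lebesgue_measure I01 k (cst c).
  apply: du_bois_reymond => // a b psi a0 b1 spsi psi0.
  have tpsi := test_fun_smooth_on a0 b1 spsi.
  have bpsi := test_fun_bounded_borel tpsi.
  have [sP dP] := primitive_smooth_on a0 b1 spsi psi0.
  have := nuw _ (test_fun_smooth_on a0 b1 sP); rewrite dP tailE//; last first.
    exact: test_fun_supported.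
  move/eqP; rewrite -subr_eq0 opprK => /eqP <-.
  rewrite -RintegralD//.
  - by apply: eq_Rintegral => t _; rewrite /k; ring.
  - apply: eq_integrable (integrable_bounded_mul (@measurable_I01 R) bpsi intw) => //.
    by move=> t _ /=; rewrite mulrC.
  - exact: (integrable_bounded_mul (@measurable_I01 R) bpsi inttail).
move=> bh h0 inth0; rewrite tailE//.
have inth := bounded_borel_integrable01 bh.
have intht := integrable_bounded_mul (@measurable_I01 R) bh inttail.
have inthw := integrable_bounded_mul (@measurable_I01 R) bh intw.
apply/eqP; rewrite -subr_eq0 opprK -RintegralD//; apply/eqP.
transitivity (\int[lebesgue_measure]_(t in I01) (h t * c)).
  congr fine; apply: ae_eq_integral => //.
  - have : lebesgue_measure.-integrable I01 (EFin \o (fun t => h t * w t + h t * tail t)).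
      by apply: eq_integrable (integrableD _ inthw intht).
    exact: measurable_int.
  - by apply: measurable_int (integrableZr _ c inth).
  - by apply: filterS kc => t /= kt /kt /= kc'; rewrite -mulrDr -/(k t) kc'.
by rewrite RintegralZr// inth0 mul0r.
Qed.

End by_parts.

(** * Smooth functions as functions of bounded variation *)

Section smooth_derivative.
Context {R : realType}.
Implicit Types (u : R -> R) (nu : signed_measure R).

Lemma continuous_integrable_cc (h : R -> R) : continuous h ->
  lebesgue_measure.-integrable `[0, 1] (EFin \o h).
Proof.
move=> ch; apply: continuous_compact_integrable; first exact: segment_compact.
exact: continuous_subspaceT.
Qed.

Lemma continuous_integrable01 (h : R -> R) : continuous h ->
  lebesgue_measure.-integrable I01 (EFin \o h).
Proof.
move=> ch; apply: integrableS (continuous_integrable_cc ch) => //.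
exact: subset_itv_oo_cc.
Qed.

Lemma Rintegral_I01_cc (h : R -> R) : continuous h ->
  \int[lebesgue_measure]_(t in `[0, 1]) h t = \int[lebesgue_measure]_(t in I01) h t.
Proof.
move=> ch; rewrite -Rintegral_itv_obnd_cbnd; last first.
  by apply: integrableS (continuous_integrable_cc ch) => //; exact: subset_itv_oc_cc.
by rewrite -Rintegral_itv_bndo_bndc//; exact: continuous_integrable01.
Qed.

Lemma derivable_LRcontinuous (u : R -> R) (a b : R) :
  (forall t : R, derivable u t 1) -> derivable_oo_LRcontinuous u a b.
Proof.
move=> du; have cu := derivable_continuous du; split => //.
- exact: cvg_at_right_filter (cu a).
- exact: cvg_at_left_filter (cu b).
Qed.

Lemma smooth_by_parts (u u' phi : R -> R) :
  (forall t : R, is_derive t 1 u (u' t)) -> continuous u' -> test_fun phi ->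
  \int[lebesgue_measure]_(t in I01) (u t * phi^`()%classic t) =
  - \int[lebesgue_measure]_(t in I01) (phi t * u' t).
Proof.
move=> du cu' tphi.
have phi_out := test_fun_supported tphi.
have dphi (t : R) : derivable phi t 1 by have [d _ _] := tphi; exact: (d 0%N).
have cphi := test_fun_continuous tphi.
have cphi' : continuous phi^`()%classic.
  by apply: derivable_continuous => t; have [d _ _] := tphi; exact: (d 1%N).
have cu : continuous u by apply: derivable_continuous => t; case: (du t).
have phi0 : phi 0 = 0 by apply: phi_out; rewrite /I01 /= in_itv/= ltxx.
have phi1 : phi 1 = 0 by apply: phi_out; rewrite /I01 /= in_itv/= ltxx andbF.
have cM (f g : R -> R) : continuous f -> continuous g -> continuous (fun t => f t * g t).
  by move=> cf cg t; apply: continuousM; [exact: cf|exact: cg].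
rewrite -!Rintegral_I01_cc; [|exact: cM..].
have dut (t : R) : derivable u t 1 by case: (du t).
have uu' : {in `]0, 1[%R, u^`() =1 u'} by move=> t _; rewrite derive1E; case: (du t).
have pp' : {in `]0, 1[%R, phi^`() =1 phi^`()} by [].
rewrite (Rintegration_by_parts ltr01 (continuous_subspaceT cu')
  (derivable_LRcontinuous _ _ dut) uu' (continuous_subspaceT cphi')
  (derivable_LRcontinuous _ _ dphi) pp').
rewrite phi0 phi1 !mulr0 subrr sub0r; congr (- _).
by apply: eq_Rintegral => t _; rewrite mulrC.
Qed.

Lemma finmeas_add (m1 m2 : finmeas R) : exists m : finmeas R,
  (forall B : set (measurableTypeR R), measurable B -> m B = (m1 B + m2 B)%E) /\
  (forall phi, bounded_borel phi -> \int[m]_t phi t = \int[m1]_t phi t + \int[m2]_t phi t).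
Proof.
have fin12 : fin_num_fun (measure_add m1 m2).
  by move=> B mB; rewrite measure_addE fin_numD !fin_num_measure.
pose m : finmeas R := HB.pack (measure_add m1 m2 : set (measurableTypeR R) -> \bar R)
   (Measure.on (measure_add m1 m2)) (Measure_isFinite.Build _ _ _ (measure_add m1 m2) fin12).
exists m; split => [B mB|phi bphi]; first exact: measure_addE.
have i1 := bounded_borel_integrable m1 measurableT bphi.
have i2 := bounded_borel_integrable m2 measurableT bphi.
transitivity (fine (\int[measure_add m1 m2]_t (phi t)%:E)) => //.
by rewrite integral_measure_add// fineD// integrable_fin_num.
Qed.

Lemma smooth_distr_derivative (u u' : R -> R) :
  (forall t : R, is_derive t 1 u (u' t)) -> continuous u' ->
  exists nu : signed_measure R, is_distr_derivative u nu.
Proof.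
move=> du cu'; have intu' := continuous_integrable01 cu'.
have intT : lebesgue_measure.-integrable setT ((EFin \o u') \_ I01).
  by apply/(integrable_mkcond _ _).1.
pose nu : signed_measure R := induced_charge intT.
have nuE B : measurable B -> nu B = (\int[lebesgue_measure]_(t in B `&` I01) (u' t)%:E)%E.
  move=> mB; rewrite integral_mkcondr; apply: eq_integral => t _.
  by rewrite restrict_EFin.
exists nu; split => [B mB BI|phi tphi]; first by rewrite nuE// BI integral_set0.
rewrite (smooth_by_parts du cu' tphi).
have [m1 [m2 [mE mint]]] := signed_density intu'.
have bphi := test_fun_bounded_borel tphi.
rewrite mint// (charge_integralE (m1 := m1) (m2 := m2))// => B mB.
by rewrite nuE// mE.
Qed.

(** Two signed measures with equal integrals of test functions agree: after moving
    negative parts to the other side, this is [finmeas_eq_test_fun]. *)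
Lemma smooth_distr_derivative_unique (u u' : R -> R) nu :
  (forall t : R, is_derive t 1 u (u' t)) -> continuous u' ->
  is_distr_derivative u nu ->
  forall B, measurable B -> nu B = (\int[lebesgue_measure]_(t in B `&` I01) (u' t)%:E)%E.
Proof.
move=> du cu' [nuI nuP]; have intu' := continuous_integrable01 cu'.
have [m1 [m2 [mE mint]]] := signed_density intu'.
pose p : finmeas R := jordan_pos (hahn_posnegP nu).
pose n : finmeas R := jordan_neg (hahn_posnegP nu).
have [q1 [q1E q1int]] := finmeas_add p m2.
have [q2 [q2E q2int]] := finmeas_add m1 n.
(* [p - n] and [m1 - m2] have the same integrals of test functions *)
have q12 B : measurable B -> q1 (B `&` I01) = q2 (B `&` I01).
  apply: finmeas_eq_test_fun => phi tphi.
  have bphi := test_fun_bounded_borel tphi.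
  rewrite q1int// q2int//.
  have := nuP _ tphi; rewrite (smooth_by_parts du cu' tphi) mint//.
  rewrite /charge_integral.
  change (- (\int[m1]_t phi t - \int[m2]_t phi t) =
          - (\int[p]_t phi t - \int[n]_t phi t) ->
          \int[p]_t phi t + \int[m2]_t phi t = \int[m1]_t phi t + \int[n]_t phi t).
  by move/oppr_inj/eqP; rewrite subr_eq => /eqP ->; rewrite addrAC subrK.
move=> B mB.
have mBI : measurable (B `&` I01) by exact: measurableI.
have -> : nu B = nu (B `&` I01).
  rewrite (chargeDI nu mB (@measurable_I01 R)).
  have -> : nu (B `\` I01) = 0%E.
    by apply: nuI; [exact: measurableD|rewrite setDE -setIA setICl setI0].
  by rewrite add0e.
have -> : B `&` I01 = (B `&` I01) `&` I01 by rewrite -setIA setIid.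
rewrite mE// -setIA setIid.
have -> : nu (B `&` I01) = (p (B `&` I01) - n (B `&` I01))%E.
  by rewrite [LHS](jordan_decomp (hahn_posnegP nu) mBI) /cadd/= cscaleN1.
apply: fin_num_addeq; rewrite ?fin_num_measure//.
by rewrite -q1E// -q2E//; exact: q12.
Qed.

End smooth_derivative.

(** * Growth of primitives *)

Section primitive_estimates.
Context {R : realType}.
Implicit Types (h : R -> R).

(** The unknowns live on [[0, 1]], but primitives integrate over the line. *)
Definition cut h (t : R) : R := h t * \1_I01 t.

Lemma cutE h t : I01 t -> cut h t = h t.
Proof. by move=> It; rewrite /cut indicE mem_set// mulr1. Qed.

Lemma cut_supported h : supported01 (cut h).
Proof. by move=> t It; rewrite /cut indicE memNset// mulr0. Qed.

Lemma cut_bounded_borel h M :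
  measurable_fun (setT : set (measurableTypeR R)) h ->
  (forall t, I01 t -> `|h t| <= M) -> 0 <= M -> bounded_borel (cut h).
Proof.
move=> mh hM M0; split.
  by apply: measurable_funM => //; exact: measurable_indic.
exists M => t; have [It|It] := pselect (I01 t); first by rewrite cutE// hM.
by rewrite cut_supported// normr0.
Qed.

Lemma primitive_lipschitz h C s t : supported01 h ->
  lebesgue_measure.-integrable I01 (EFin \o h) -> (forall r, `|h r| <= C) ->
  `|primitive h t - primitive h s| <= C * `|t - s|.
Proof.
move=> h0 inth hC; wlog st : s t / s <= t.
  move=> H; have [st|/ltW st] := leP s t; first exact: H.
  by rewrite distrC (distrC t); exact: H.
have -> : `|t - s| = t - s by rewrite ger0_norm ?subr_ge0.
rewrite ler_norml -mulNr; apply/andP; split.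
  by apply: primitive_ge => // r _; have := hC r; rewrite ler_norml => /andP[].
by apply: primitive_le => // r _; have := hC r; rewrite ler_norml => /andP[].
Qed.

Lemma primitiveN h t : supported01 h ->
  lebesgue_measure.-integrable I01 (EFin \o h) ->
  primitive (fun r => - h r) t = - primitive h t.
Proof.
move=> h0 inth; rewrite /primitive -mulN1r -RintegralZl//.
  by apply: eq_Rintegral => r _; rewrite mulN1r.
exact: integrable_supported.
Qed.

Lemma primitiveB h1 h2 t : supported01 h1 -> supported01 h2 ->
  lebesgue_measure.-integrable I01 (EFin \o h1) ->
  lebesgue_measure.-integrable I01 (EFin \o h2) ->
  primitive (fun r => h1 r - h2 r) t = primitive h1 t - primitive h2 t.
Proof.
move=> h10 h20 int1 int2; rewrite /primitive RintegralB//; exact: integrable_supported.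
Qed.

(** The comparison function [D exp (k t)] reproduces itself, up to the factor [k],
    under integration: this is what makes the weighted norm below contract. *)
Lemma primitive_exp_le h (D k t : R) : supported01 h ->
  lebesgue_measure.-integrable I01 (EFin \o h) -> 0 < k -> 0 <= t <= 1 ->
  0 <= D ->
  (forall r, I01 r -> h r <= D * (k * expR (k * r))) ->
  primitive h t <= D * (expR (k * t) - 1).
Proof.
move=> h0 inth k0 /andP[]; rewrite le_eqVlt => /predU1P[<- _ _ _|t0 t1 D0 hD].
  by rewrite primitive_le0// mulr0 expR0 subrr mulr0.
have cexp : continuous (fun r : R => D * (k * expR (k * r))).
  move=> r; apply: cvgM; first exact: cvg_cst.
  apply: cvgM; first exact: cvg_cst.
  apply: continuous_comp; last exact: continuous_expR.
  by apply: cvgM; [exact: cvg_cst|exact: cvg_id].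
have dexp (r : R) : is_derive r 1 (fun r : R => D * expR (k * r)) (D * (k * expR (k * r))).
  have dk : is_derive r 1 (fun r : R => k * r) k.
    by have := is_deriveZ k (is_derive_id r 1); rewrite /GRing.scale/= mulr1.
  have de : is_derive r 1 (fun r : R => expR (k * r)) (expR (k * r) * k).
    exact: (@is_derive1_comp _ expR (fun r : R => k * r)).
  by rewrite (mulrC k); exact: is_deriveZ.
have E : (\int[lebesgue_measure]_(r in `[0%R, t]) (D * (k * expR (k * r)))%:E =
    (D * expR (k * t))%:E - (D * expR (k * 0))%:E)%E.
  apply: (@continuous_FTC2 R _ (fun r => D * expR (k * r)) _ _ t0).
  - exact: continuous_subspaceT.
  - by apply: derivable_LRcontinuous => r; case: (dexp r).
  - by move=> r _; rewrite derive1E; case: (dexp r).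
have intexp : lebesgue_measure.-integrable `[0, t] (EFin \o (fun r => D * (k * expR (k * r)))).
  apply: continuous_compact_integrable; first exact: segment_compact.
  exact: continuous_subspaceT.
have intexp' : lebesgue_measure.-integrable `]0, t] (EFin \o (fun r => D * (k * expR (k * r)))).
  by apply: integrableS intexp => //; exact: subset_itv_oc_cc.
rewrite -[leLHS]subr0 -(primitive_le0 h0 (lexx 0)) primitive_increment ?(ltW t0)//.
have -> : D * (expR (k * t) - 1) =
    \int[lebesgue_measure]_(r in `]0, t]) (D * (k * expR (k * r))).
  rewrite Rintegral_itv_obnd_cbnd// /Rintegral E -EFinB/= mulr0 expR0.
  by rewrite mulr1 mulrBr mulr1.
apply: le_Rintegral => //; first exact: integrable_supported.
move=> r; rewrite /= in_itv/= => /andP[r0 rt].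
have [r1|r1] := ltP r 1; first by apply: hD; rewrite /I01/= in_itv/= r0 r1.
have rE : r = 1 by apply/eqP; rewrite eq_le r1 (le_trans rt t1).
rewrite h0; last by rewrite /I01/= in_itv/= rE ltxx andbF.
by rewrite mulr_ge0// mulr_ge0 ?expR_ge0 ?(ltW k0).
Qed.

Lemma cut_ge0 h t : (forall r, 0 <= h r) -> 0 <= cut h t.
Proof. by move=> h0; rewrite /cut indicE mulr_ge0. Qed.

Lemma cut_le0 h t : (forall r, h r <= 0) -> cut h t <= 0.
Proof. by move=> h0; rewrite /cut indicE mulr_le0_ge0. Qed.

Lemma primitive_npos h t : bounded_borel h -> supported01 h ->
  (forall r, h r <= 0) -> primitive h t <= 0.
Proof.
move=> bh h0 hle; rewrite -oppr_ge0 -primitiveN//; last exact: bounded_borel_integrable01.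
by apply: Rintegral_ge0 => r _; rewrite oppr_ge0.
Qed.

End primitive_estimates.

Lemma lipschitz_continuous (R : realType) (f : R -> R) (K : R) :
  (forall s t : R, `|f t - f s| <= K * `|t - s|) -> continuous f.
Proof.
move=> fK x; apply/cvgrPdist_le => e e0; near=> y.
rewrite (le_trans (fK _ _))//.
have K1 : 0 < `|K| + 1 by rewrite ltr_wpDl.
rewrite (@le_trans _ _ ((`|K| + 1) * `|x - y|))//.
  by rewrite ler_wpM2r// (le_trans (ler_norm K))// lerDl.
rewrite -ler_pdivlMl// mulrC; apply: ltW; near: y.
by apply: (@cvgr_dist_lt _ _ _ _ _ id) => //; rewrite divr_gt0.
Unshelve. all: by end_near. Qed.

Lemma geometric_small (R : realType) (C e : R) : 0 < e -> exists n, C / 2 ^+ n <= e.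
Proof.
move=> e0; have [n nC] : exists n, `|C| / e < n%:R.
  by exists (Num.Def.archi_bound (`|C| / e)); apply: archi_boundP; rewrite divr_ge0// ltW.
exists n; rewrite ler_pdivrMr ?exprn_gt0// (le_trans (ler_norm C))//.
rewrite -ler_pdivrMl// mulrC (le_trans (ltW nC))// -natrX ler_nat.
by rewrite ltnW// ltn_expl.
Qed.

Lemma cvg_norm_le (R : realType) (w : nat -> R) (l B : R) : w n @[n --> \oo] --> l ->
  (\forall n \near \oo, `|w n| <= B) -> `|l| <= B.
Proof.
move=> wl wB; apply/ler_addgt0Pr => e e0.
near \oo => n.
have ln : `|l - w n| < e by near: n; exact: cvgr_dist_lt.
rewrite -[X in `|X|](subrK (w n)) (le_trans (ler_normD _ _))// addrC.
by apply: lerD; [near: n|exact: ltW].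
Unshelve. all: by end_near. Qed.

(** * The Neumann problem with a truncated nonlinearity *)

Section cauchy_problem.
Context {R : realType}.
Variables (psi g : R -> R) (lam L M : R).
Hypothesis psi_lip : forall x y, `|psi x - psi y| <= L * `|x - y|.
Hypothesis psi_bound : forall x, `|psi x| <= M.
Hypothesis psi_mono : forall x y, x <= y -> psi x <= psi y.
Hypothesis psi0 : psi 0 = 0.
Hypothesis L_ge0 : 0 <= L.
Hypothesis M_ge0 : 0 <= M.
Hypothesis lam_gt0 : 0 < lam.
Hypothesis mg : measurable_fun (setT : set (measurableTypeR R)) g.
Hypothesis g01 : forall t, 0 <= g t <= 1.
Implicit Types (sig : R -> R) (a b d s t : R).

(** The system is solved as a fixed point problem for the stress [sig] alone:
    [position] is the solution of [u' = psi sig], [u 0 = a], [force] is the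
    right-hand side [lam (u - g)] of the stress equation, and [step] integrates it
    from [sig 0 = 0]. *)
Definition position a sig t : R := a + primitive (cut (psi \o sig)) t.

Definition force a sig : R -> R := cut (fun t => lam * (position a sig t - g t)).

Definition step a sig : R -> R := primitive (force a sig).

Lemma psi_continuous : continuous psi.
Proof. by apply: (@lipschitz_continuous _ _ L) => s t; exact: psi_lip. Qed.

Lemma bounded_velocity sig : continuous sig -> bounded_borel (cut (psi \o sig)).
Proof.
move=> csig; apply: (@cut_bounded_borel _ _ M) => //.
  apply: continuous_measurable_fun => t.
  by apply: continuous_comp; [exact: csig|exact: psi_continuous].
by move=> t _ /=.
Qed.

Lemma position_lipschitz a sig s t : continuous sig ->
  `|position a sig t - position a sig s| <= M * `|t - s|.
Proof.
move=> csig; have bv := bounded_velocity csig.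
have -> : position a sig t - position a sig s =
    primitive (cut (psi \o sig)) t - primitive (cut (psi \o sig)) s.
  by rewrite /position; ring.
apply: primitive_lipschitz; first exact: cut_supported.
  exact: bounded_borel_integrable01.
move=> r; have [Ir|Ir] := pselect (I01 r); first by rewrite cutE//=.
by rewrite cut_supported// normr0.
Qed.

Lemma position_bound a sig t : continuous sig -> I01 t ->
  `|position a sig t| <= `|a| + M.
Proof.
move=> csig; rewrite /I01 /= in_itv/= => /andP[t0 t1].
have := position_lipschitz a 0 t csig.
rewrite {2}/position primitive_le0//; last exact: cut_supported.
rewrite addr0 subr0 (gtr0_norm t0) => H.
rewrite -[X in `|X|](subrK a) (le_trans (ler_normD _ _))// addrC lerD2l.
by rewrite (le_trans H)// ler_piMr// ltW.
Qed.

Definition force_bound a := lam * (`|a| + M + 1).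

Lemma force_bound_ge0 a : 0 <= force_bound a.
Proof. by rewrite mulr_ge0 ?addr_ge0// ltW. Qed.

Lemma forceP a sig t : continuous sig -> `|force a sig t| <= force_bound a.
Proof.
move=> csig; have [It|It] := pselect (I01 t); last first.
  by rewrite /force cut_supported// normr0 force_bound_ge0.
rewrite /force cutE// normrM gtr0_norm// ler_wpM2l ?(ltW lam_gt0)//.
rewrite (le_trans (ler_normB _ _))// lerD ?position_bound//.
by have /andP[g0 g1] := g01 t; rewrite ger0_norm.
Qed.

Lemma force_bounded_borel a sig : continuous sig -> bounded_borel (force a sig).
Proof.
move=> csig; apply: (@cut_bounded_borel _ _ (force_bound a)).
- apply: measurable_funM => //; apply: measurable_funB => //.
  apply: continuous_measurable_fun; apply: (@lipschitz_continuous _ _ M) => s t.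
  exact: position_lipschitz.
- by move=> t It; have := forceP a t csig; rewrite /force cutE.
- exact: force_bound_ge0.
Qed.

Lemma step_lipschitz a sig s t : continuous sig ->
  `|step a sig t - step a sig s| <= force_bound a * `|t - s|.
Proof.
move=> csig; apply: primitive_lipschitz; first exact: cut_supported.
  by apply: bounded_borel_integrable01; exact: force_bounded_borel.
by move=> r; exact: forceP.
Qed.

Lemma step_le0 a sig t : t <= 0 -> step a sig t = 0.
Proof. by move=> t0; rewrite /step primitive_le0//; exact: cut_supported. Qed.

Lemma step_ge1 a sig t : 1 <= t -> step a sig t = step a sig 1.
Proof. by move=> t1; rewrite /step !primitive_ge1//; exact: cut_supported. Qed.

(** In the norm [sup |sig t| exp (- rate t)] each integration gains a factor
    [1 / rate], so that [step] has Lipschitz constant at most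
    [lam L / rate <= 1 / 2]. *)
Definition rate := 1 + 2 * lam * L.

Definition weighted_le d sig := forall t, 0 <= t <= 1 -> `|sig t| <= d * expR (rate * t).

Lemma rate_ge1 : 1 <= rate.
Proof. by rewrite lerDl !mulr_ge0// ltW. Qed.

Lemma primitive_weighted (h : R -> R) d t : supported01 h -> bounded_borel h -> 0 <= d ->
  (forall r, I01 r -> `|h r| <= d * (rate * expR (rate * r))) ->
  0 <= t <= 1 -> `|primitive h t| <= d * (expR (rate * t) - 1).
Proof.
move=> h0 bh d0 hd t01.
have rate0 : 0 < rate := lt_le_trans ltr01 rate_ge1.
have inth := bounded_borel_integrable01 bh.
have intN : lebesgue_measure.-integrable I01 (EFin \o (fun r => - h r)).
  apply: bounded_borel_integrable01; have [mh [C hC]] := bh; split.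
    by apply: measurableT_comp.
  by exists C => r; rewrite normrN.
rewrite ler_norml; apply/andP; split.
  rewrite lerNl -primitiveN//; apply: primitive_exp_le => //.
    by move=> r /h0 ->; rewrite oppr0.
  by move=> r /hd; rewrite ler_norml lerNl => /andP[].
by apply: primitive_exp_le => // r /hd; rewrite ler_norml => /andP[].
Qed.

(** The term in [|a - b|] measures the dependence on the initial value and yields
    the continuity of the shooting map. *)
Lemma step_contraction a b sig1 sig2 d : continuous sig1 -> continuous sig2 -> 0 <= d ->
  weighted_le d (fun t => sig1 t - sig2 t) ->
  weighted_le (d / 2 + lam * `|a - b|) (fun t => step a sig1 t - step b sig2 t).
Proof.
move=> c1 c2 d0 sd t t01.
have rate0 : 0 < rate := lt_le_trans ltr01 rate_ge1.
have posd r : 0 <= r <= 1 -> `|position a sig1 r - position b sig2 r| <=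
    (`|a - b| + d * L / rate) * expR (rate * r).
  move=> r01; pose v r := cut (psi \o sig1) r - cut (psi \o sig2) r.
  have v0 : supported01 v by move=> q Iq; rewrite /v !cut_supported// subrr.
  have bv1 := bounded_velocity c1; have bv2 := bounded_velocity c2.
  have bv : bounded_borel v.
    have [m1 [M1 h1]] := bv1; have [m2 [M2 h2]] := bv2.
    split; first exact: measurable_funB.
    by exists (M1 + M2) => q; rewrite (le_trans (ler_normB _ _))// lerD.
  have -> : position a sig1 r - position b sig2 r = (a - b) + primitive v r.
    rewrite primitiveB; [|exact: cut_supported|exact: cut_supported
      |exact: bounded_borel_integrable01|exact: bounded_borel_integrable01].
    by rewrite /position; ring.
  have e1 : 1 <= expR (rate * r).
    by rewrite -expR0 ler_expR mulr_ge0 ?(ltW rate0)//; case/andP: r01.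
  rewrite (le_trans (ler_normD _ _))// mulrDl lerD//.
    by rewrite ler_peMr.
  have dLr : 0 <= d * L / rate by rewrite divr_ge0 ?mulr_ge0// ltW.
  apply: (@le_trans _ _ (d * L / rate * (expR (rate * r) - 1))).
    apply: primitive_weighted => // q Iq; rewrite /v !cutE//= mulrA divfK ?gt_eqF//.
    rewrite (le_trans (psi_lip _ _))// mulrC -mulrA [X in _ <= _ * X]mulrC mulrA.
    rewrite ler_wpM2r//; apply: sd; move: Iq; rewrite /I01/= in_itv/= => /andP[q0 q1].
    by rewrite !ltW.
  by rewrite ler_wpM2l// gerBl.
pose w r := force a sig1 r - force b sig2 r.
have w0 : supported01 w by move=> q Iq; rewrite /w /force !cut_supported// subrr.
have bf1 := force_bounded_borel a c1; have bf2 := force_bounded_borel b c2.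
have bw : bounded_borel w.
  have [m1 [M1 h1]] := bf1; have [m2 [M2 h2]] := bf2.
  split; first exact: measurable_funB.
  by exists (M1 + M2) => q; rewrite (le_trans (ler_normB _ _))// lerD.
have -> : step a sig1 t - step b sig2 t = primitive w t.
  by rewrite primitiveB//; [exact: cut_supported|exact: cut_supported
    |exact: bounded_borel_integrable01|exact: bounded_borel_integrable01].
pose D := lam * (`|a - b| + d * L / rate) / rate.
have D0 : 0 <= D.
  by rewrite !(mulr_ge0, addr_ge0, invr_ge0) ?(ltW rate0) ?(ltW lam_gt0).
apply: (@le_trans _ _ (D * (expR (rate * t) - 1))).
  apply: primitive_weighted => // r Ir.
  have r01 : 0 <= r <= 1.
    by move: Ir; rewrite /I01/= in_itv/= => /andP[? ?]; rewrite !ltW.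
  rewrite /w /force !cutE// -mulrBr.
  have -> : position a sig1 r - g r - (position b sig2 r - g r) =
     position a sig1 r - position b sig2 r by ring.
  rewrite normrM gtr0_norm// /D mulrA divfK ?gt_eqF// -mulrA.
  by rewrite ler_wpM2l ?(ltW lam_gt0)// posd.
rewrite (@le_trans _ _ (D * expR (rate * t)))//; first by rewrite ler_wpM2l// gerBl.
rewrite ler_wpM2r ?expR_ge0// /D ler_pdivrMr// mulrDr addrC mulrDl; apply: lerD.
  apply: (@le_trans _ _ (lam * (d * L))).
    by rewrite ler_wpM2l ?(ltW lam_gt0)// ler_pdivrMr// ler_peMr ?mulr_ge0// rate_ge1.
  have -> : d / 2 * rate = lam * (d * L) + d / 2 by rewrite /rate; field.
  by rewrite lerDl divr_ge0.
by rewrite ler_peMr ?rate_ge1// mulr_ge0// ltW.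
Qed.

Definition picard a (n : nat) : R -> R := iter n (step a) (fun=> 0).

Lemma picard_continuous a n : continuous (picard a n).
Proof.
elim: n => [|n IH]; first exact: cst_continuous.
apply: (@lipschitz_continuous _ _ (force_bound a)) => s t.
exact: step_lipschitz.
Qed.

(** The iterates are constant on both sides of [[0, 1]], so estimates on that
    interval determine them everywhere. *)
Definition clip01 t : R := Num.max 0 (Num.min t 1).

Lemma clip01_itv t : 0 <= clip01 t <= 1.
Proof. by rewrite le_max lexx ge_max ler01 ge_min lexx orbT. Qed.

Lemma picard_clip a n t : picard a n t = picard a n (clip01 t).
Proof.
case: n => // n; rewrite /picard /= /clip01.
have [t1|t1] := leP t 1; have [t0|t0] := leP 0 t.
- by [].
- by rewrite !step_le0// ltW.
- by rewrite max_r// step_ge1// ltW.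
- by have := lt_trans t1 t0; rewrite ltNge ler01.
Qed.

(** With [B] the force bound, the first iterate is at most [B], and the contraction
    factor [1/2] turns a bound [2 B] into [B + B]. *)
Lemma picard_bound a p : weighted_le (2 * force_bound a) (picard a p).
Proof.
have F0 := force_bound_ge0 a.
have rate0 : 0 < rate := lt_le_trans ltr01 rate_ge1.
elim: p => [|p IH] t t01.
  by rewrite /picard /= normr0 mulr_ge0 ?expR_ge0// mulr_ge0.
have H1 : `|picard a 1 t| <= force_bound a * expR (rate * t).
  have /andP[t0 t1] := t01.
  have := step_lipschitz a 0 t (@cst_continuous _ _ (0 : R)).
  rewrite [X in _ - X]step_le0// !subr0 (ger0_norm t0) => /le_trans; apply.
  rewrite ler_wpM2l// (le_trans t1)// -expR0 ler_expR.
  by rewrite mulr_ge0// ltW.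
have H2 : `|picard a p.+1 t - picard a 1 t| <= force_bound a * expR (rate * t).
  have := @step_contraction a a (picard a p) (picard a 0) (2 * force_bound a)
     (picard_continuous (n := p)) (picard_continuous (n := 0)).
  rewrite subrr normr0 mulr0 addr0 mulrAC divff// mul1r.
  apply => //; first by rewrite mulr_ge0.
  by move=> r r01; rewrite subr0; exact: IH.
rewrite -[X in `|X|](subrK (picard a 1 t)) (le_trans (ler_normD _ _))//.
rewrite (_ : 2 * _ * _ = force_bound a * expR (rate * t) + force_bound a * expR (rate * t)).
  exact: lerD.
by ring.
Qed.

Lemma picard_cauchy a p n :
  weighted_le (2 * force_bound a / 2 ^+ n) (fun t => picard a (p + n) t - picard a n t).
Proof.
have F0 := force_bound_ge0 a.
elim: n => [|n IH].
  move=> t t01; rewrite expr0 divr1 addn0 /picard /= subr0.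
  exact: picard_bound.
have d0 : 0 <= 2 * force_bound a / 2 ^+ n by apply: divr_ge0; [exact: mulr_ge0|exact: exprn_ge0].
have := @step_contraction a a _ _ _ (picard_continuous (n := p + n))
  (picard_continuous (n := n)) d0 IH.
by rewrite subrr normr0 mulr0 addr0 addnS exprSr invfM [in X in _ -> X]mulrA.
Qed.

(** The stress of the solution started from [u 0 = a]; the shooting method looks for
    a zero of [shoot a 1]. *)
Definition shoot a t : R := lim (picard a n t @[n --> \oo]).

Lemma picard_cvg a t : picard a n t @[n --> \oo] --> shoot a t.
Proof.
suff : cvg (picard a n t @[n --> \oo]) by [].
have -> : (fun n => picard a n t) = (fun n => picard a n (clip01 t)).
  by apply/funext => n; exact: picard_clip.
have t01 := clip01_itv t; set r := clip01 t in t01 *.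
suff ex : cauchy_ex (picard a n r @[n --> \oo]).
  by apply: cauchy_cvg; exact: cauchy_exP.
move=> e e0.
have [n ne] := geometric_small (2 * force_bound a * expR (rate * r)) (divr_gt0 e0 (ltr0n R 2)).
exists (picard a n r); exists n => // m /= nm.
rewrite /ball /= distrC -(subnK nm).
rewrite (le_lt_trans (@picard_cauchy a (m - n)%N n r t01))//.
by rewrite mulrAC (le_lt_trans ne)// ltr_pdivrMr// ltr_pMr// ltr1n.
Qed.

Lemma shoot_dist a n :
  weighted_le (2 * force_bound a / 2 ^+ n) (fun t => shoot a t - picard a n t).
Proof.
move=> t t01; apply: (@cvg_norm_le _ (fun m => picard a m t - picard a n t)).
  by apply: cvgB; [exact: picard_cvg|exact: cvg_cst].
by exists n => // m /= nm; rewrite -(subnK nm); exact: picard_cauchy.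
Qed.

Lemma shoot_lipschitz a s t : `|shoot a t - shoot a s| <= force_bound a * `|t - s|.
Proof.
apply: (@cvg_norm_le _ (fun m => picard a m t - picard a m s)).
  by apply: cvgB; exact: picard_cvg.
exists 1%N => // -[//|m] _ /=; apply: step_lipschitz; exact: picard_continuous.
Qed.

Lemma shoot_continuous a : continuous (shoot a).
Proof. by apply: (@lipschitz_continuous _ _ (force_bound a)) => s t; exact: shoot_lipschitz. Qed.

Lemma shoot_clip a t : shoot a t = shoot a (clip01 t).
Proof. by rewrite /shoot; under eq_fun do rewrite picard_clip. Qed.

Lemma shoot_fixed a t : shoot a t = step a (shoot a) t.
Proof.
have F0 := force_bound_ge0 a.
suff H r : 0 <= r <= 1 -> shoot a r = step a (shoot a) r.
  have t01 := clip01_itv t; rewrite shoot_clip H//.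
  rewrite /clip01; have [t1|t1] := leP t 1; have [t0|t0] := leP 0 t.
  - by [].
  - by rewrite !step_le0// ltW.
  - by rewrite max_r// [RHS]step_ge1// ltW.
  - by have := lt_trans t1 t0; rewrite ltNge ler01.
move=> r01; apply/eqP; rewrite -subr_eq0 -normr_le0; apply/ler_addgt0Pr => e e0.
have [n ne] := geometric_small (2 * force_bound a * expR (rate * r)) e0.
have d0 : 0 <= 2 * force_bound a / 2 ^+ n by apply: divr_ge0; [exact: mulr_ge0|exact: exprn_ge0].
have := @step_contraction a a _ _ _ (picard_continuous (n := n)) (@shoot_continuous a) d0.
rewrite subrr normr0 mulr0 addr0 => H.
have {H}/(_ r r01) H : weighted_le (2 * force_bound a / 2 ^+ n / 2)
    (fun t => step a (picard a n) t - step a (shoot a) t).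
  by apply: H => q q01; rewrite distrC; exact: shoot_dist.
have H' := shoot_dist a n.+1 r01; rewrite [picard a n.+1]/picard iterS -/(picard a n) in H'.
rewrite add0r -[X in `|X|](subrKA (step a (picard a n) r)).
rewrite (le_trans (ler_normD _ _))// (le_trans (lerD H' H))//.
have hE : 2 * force_bound a / 2 ^+ n.+1 = 2 * force_bound a / 2 ^+ n / 2.
  by rewrite exprSr invfM [LHS]mulrA.
by rewrite (le_trans _ ne)// hE -mulrDl -splitr mulrAC.
Qed.

(** The constant [2 lam |a - b|] is the fixed point of the affine bound
    [d / 2 + lam |a - b|] of [step_contraction], hence uniform in [n]. *)
Lemma picard_initial a b n :
  weighted_le (2 * lam * `|a - b|) (fun t => picard a n t - picard b n t).
Proof.
have ab0 : 0 <= 2 * lam * `|a - b| by rewrite !mulr_ge0// ltW.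
elim: n => [|n IH].
  by move=> t _; rewrite /picard /= subrr normr0 mulr_ge0// expR_ge0.
have := @step_contraction a b _ _ _ (picard_continuous (n := n)) (picard_continuous (n := n)) ab0 IH.
have -> // : 2 * lam * `|a - b| / 2 + lam * `|a - b| = 2 * lam * `|a - b| by field.
Qed.

Lemma shoot_initial_continuous : continuous (fun a => shoot a 1).
Proof.
apply: (@lipschitz_continuous _ _ (2 * lam * expR rate)) => b a.
apply: (@cvg_norm_le _ (fun m => picard a m 1 - picard b m 1)).
  by apply: cvgB; exact: picard_cvg.
exists 0%N => // m _ /=; have := @picard_initial a b m 1; rewrite ler01 lexx mulr1.
by move=> /(_ isT); rewrite mulrAC.
Qed.

(** With [u 0 = 0] and nonpositive stress, [u] stays nonpositive, hence below [g], so
    that the next stress is nonpositive again. *)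
Lemma picard0_le0 n t : picard 0 n t <= 0.
Proof.
elim: n t => [|n IH] t; first exact: lexx.
have cn := @picard_continuous 0 n.
apply: primitive_npos; [exact: force_bounded_borel|exact: cut_supported|move=> r].
apply: cut_le0 => q; rewrite pmulr_rle0// subr_le0.
have /andP[g0 _] := g01 q; apply: le_trans g0; rewrite /position add0r.
apply: primitive_npos; [exact: bounded_velocity|exact: cut_supported|move=> x].
by apply: cut_le0 => y /=; have := psi_mono (IH y); rewrite psi0.
Qed.

Lemma picard1_ge0 n t : 0 <= picard 1 n t.
Proof.
elim: n t => [|n IH] t; first exact: lexx.
have cn := @picard_continuous 1 n.
apply: Rintegral_ge0 => r _; apply: cut_ge0 => q; rewrite pmulr_rge0// subr_ge0.
have /andP[_ g1] := g01 q; apply: (le_trans g1); rewrite /position lerDl.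
apply: Rintegral_ge0 => x _.
by apply: cut_ge0 => y /=; have := psi_mono (IH y); rewrite psi0.
Qed.

(** Shooting from [a = 0] ends with nonpositive stress and from [a = 1] with
    nonnegative stress. *)
Lemma truncated_neumann_problem : exists a sig,
  [/\ 0 <= a <= 1, continuous sig, sig 1 = 0,
      forall t, sig t = primitive (force a sig) t
    & supported01 sig].
Proof.
have s0 : shoot 0 1 <= 0.
  apply: limr_le; first exact: picard_cvg.
  by apply: nearW => n; exact: picard0_le0.
have s1 : 0 <= shoot 1 1.
  apply: limr_ge; first exact: picard_cvg.
  by apply: nearW => n; exact: picard1_ge0.
have [a a01 sa] : exists2 a, a \in `[0, 1]%R & shoot a 1 = 0.
  apply: IVT => //; first by apply: continuous_subspaceT; exact: shoot_initial_continuous.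
  by rewrite ge_min s0 le_max s1 orbT.
exists a, (shoot a); split => //.
- exact: shoot_continuous.
- by move=> t; exact: shoot_fixed.
- move=> t; rewrite /I01/= in_itv/= => /negP; rewrite negb_and -!leNgt => /orP[t0|t1].
    by rewrite shoot_fixed step_le0.
  by rewrite shoot_fixed step_ge1// -shoot_fixed.
Qed.

End cauchy_problem.

(** * A priori bounds *)

Section first_and_last_time.
Context {R : realType}.
Implicit Types (f : R -> R).

Lemma last_nonpos_time f (s t : R) : continuous f -> s <= t -> f s <= 0 -> 0 < f t ->
  exists r, [/\ s <= r, r < t, f r <= 0 & forall q, r < q <= t -> 0 < f q].
Proof.
move=> cf st fs ft.
pose A : set R := `[s, t] `&` f @^-1` `]-oo, 0].
have cA : compact A.
  apply: compact_closedI; first exact: segment_compact.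
  by apply: closed_comp => //; exact: interval_closed.
have A0 : A !=set0 by exists s; split; rewrite /= in_itv/= ?lexx.
have [r] := @compact_EVT_max _ R id A A0 cA (continuous_subspaceT (fun x : R => @cvg_id R (nbhs x))).
rewrite inE => -[/=]; rewrite !in_itv/= => /andP[sr rt] fr rmax.
exists r; split => //.
  by rewrite lt_neqAle rt andbT; apply: contraTneq fr => ->; rewrite -ltNge.
move=> q /andP[rq qt]; rewrite ltNge; apply/negP => fq.
have /rmax : q \in A by rewrite inE; split; rewrite /= in_itv/= ?(le_trans sr (ltW rq)).
by rewrite leNgt rq.
Qed.

Lemma first_nonpos_time f (s t : R) : continuous f -> s <= t -> 0 < f s -> f t <= 0 ->
  exists r, [/\ s < r, r <= t, f r <= 0 & forall q, s <= q < r -> 0 < f q].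
Proof.
move=> cf st fs ft.
have cfN : continuous (fun x : R => f (- x)).
  by move=> x; apply: continuous_comp; [exact: opp_continuous|exact: cf].
have [|||r [tr rs fr H]] := @last_nonpos_time _ (- t) (- s) cfN.
- by rewrite lerN2.
- by rewrite opprK.
- by rewrite opprK.
exists (- r); split => //; [by rewrite ltrNr|by rewrite lerNl|move=> q /andP[sq qr]].
by rewrite -[q]opprK H// lerN2 sq ltrNr qr.
Qed.

End first_and_last_time.

Section a_priori_bounds.
Context {R : realType}.
Variables (u sig psi : R -> R).
Hypothesis csig : continuous sig.
Hypothesis du : forall t : R, is_derive t 1 u (psi (sig t)).
Hypothesis psi_mono : forall x y, x <= y -> psi x <= psi y.
Hypothesis psi0 : psi 0 = 0.

Let cu : continuous u.
Proof. by apply: derivable_continuous => t; case: (du t). Qed.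

Lemma increment_mvt (s t : R) : s < t ->
  exists2 r, s < r < t & u t - u s = psi (sig r) * (t - s).
Proof.
move=> st; have [|r] := MVT st (fun x _ => du x); first exact: continuous_subspaceT.
by rewrite in_itv/= => ? ?; exists r.
Qed.

(** The monotonicity hypothesis says that the stress increases while [u] exceeds [1],
    which holds when [sig' = lam (u - g)] and [g <= 1].  Suppose [u t1 > 1].  If
    [sig t1 <= 0], then before [t1], back to the last time at which [u <= 1], the
    stress is nonpositive and [u] decreases, although it rises from at most [1] to
    above [1].  If [sig t1 > 0], then [u] and hence [sig] keep increasing after [t1],
    so the stress cannot return to [0] at time [1]. *)
Lemma maximum_principle : sig 1 = 0 -> u 0 <= 1 ->
  (forall s t : R, 0 <= s -> s <= t -> t <= 1 ->
     (forall r : R, s < r <= t -> 1 < u r) -> sig s <= sig t) ->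
  forall t, 0 <= t <= 1 -> u t <= 1.
Proof.
move=> sig1 u0 mono t1 /andP[t10 t11]; rewrite leNgt; apply/negP => ut1.
have [sigt1|sigt1] := leP (sig t1) 0.
  have [||||r [r0 rt ur H]] := @last_nonpos_time _ (fun t => u t - 1) 0 t1.
  - by move=> x; apply: cvgB; [exact: cu|exact: cvg_cst].
  - exact: t10.
  - by rewrite subr_le0.
  - by rewrite subr_gt0.
  have u1 q : r < q <= t1 -> 1 < u q by move=> /H; rewrite subr_gt0.
  have [q /andP[rq qt] uE] := increment_mvt rt.
  have : u t1 - u r <= 0.
    have pq : psi (sig q) <= 0.
      rewrite -psi0 psi_mono//; apply: le_trans sigt1; apply: mono => //.
      - exact: le_trans r0 (ltW rq).
      - exact: ltW.
      - by move=> x /andP[qx xt]; apply: u1; rewrite xt (lt_trans rq).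
    by rewrite uE mulr_le0_ge0// subr_ge0 ltW.
  rewrite subr_le0 => /(lt_le_trans ut1).
  by rewrite ltNge -subr_le0 ur.
have [|||r [tr r1 sigr H]] := @first_nonpos_time _ sig t1 1 csig => //.
  by rewrite sig1.
have u1 q : t1 <= q <= r -> 1 < u q.
  move=> /andP[]; rewrite le_eqVlt => /predU1P[<- //|tq qr].
  apply: (lt_le_trans ut1).
  have [x /andP[tx xq] uE] := increment_mvt tq.
  have px : 0 <= psi (sig x).
    by rewrite -psi0 psi_mono// ltW// H// (ltW tx) (lt_le_trans xq).
  by rewrite -subr_ge0 uE mulr_ge0// subr_ge0 ltW.
suff : sig t1 <= sig r by move=> /le_trans/(_ sigr); rewrite leNgt sigt1.
apply: mono => //; first exact: ltW.
by move=> q /andP[tq qr]; apply: u1; rewrite (ltW tq) qr.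
Qed.

(** Instead of integrating, the rise of [u] is compared with an explicit primitive.
    Along [tau p = t1 - (f1 M - f1 p) / lam] the stress is at least [f1 p], so the
    function [v p = u (tau p) - (c1 / lam) (ln (1 + p) + 1 / (1 + p))] is
    nondecreasing, the subtracted term being a primitive of
    [(c1 / lam) p / (1 + p)^2].  Comparing [v 0] with [v M] bounds [ln (1 + M) - 1]
    by [lam / c1].  The bound is one-sided, so that a reflection
    gives the other side. *)
Lemma gradient_bound (lam c1 M : R) (f1 f2 : R -> R) :
  0 < lam -> 0 < M -> 0 <= c1 ->
  (forall p : R, is_derive p 1 f1 (f2 p)) ->
  (forall p q, p <= q -> f1 p <= f1 q) -> f1 0 = 0 ->
  (forall p, 0 <= p <= M -> psi (f1 p) = p) ->
  (forall p, 0 <= p <= M -> c1 / (1 + p) ^+ 2 <= f2 p) ->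
  lam < c1 * (ln (1 + M) - 1) ->
  sig 0 = 0 ->
  (forall s t : R, 0 <= s -> s <= t -> t <= 1 -> sig t - sig s <= lam * (t - s)) ->
  (forall t, 0 <= t <= 1 -> 0 <= u t <= 1) ->
  forall t, 0 <= t <= 1 -> sig t < f1 M.
Proof.
move=> lam0 M0 c10 df1 f1mono f10 psif1 f2c Mlarge sig0 siglip u01 t1 /andP[t10 t11].
rewrite ltNge; apply/negP => sM.
pose S := f1 M; pose tau p := t1 - (S - f1 p) / lam.
have St1 : S <= lam * t1.
  rewrite (le_trans sM)//; have := siglip 0 t1 (lexx 0) t10 t11.
  by rewrite sig0 !subr0.
have tau_itv p : 0 <= p <= M -> 0 <= tau p <= t1.
  move=> /andP[p0 pM]; rewrite subr_ge0 ler_pdivrMr// mulrC gerBl divr_ge0 ?(ltW lam0) ?subr_ge0 ?f1mono// andbT.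
  by rewrite (le_trans _ St1)// gerBl -f10 f1mono.
have sig_tau p : 0 <= p <= M -> f1 p <= sig (tau p).
  move=> /[dup] pM /tau_itv/andP[tau0 taut].
  have := siglip _ _ tau0 taut t11; rewrite {2}/tau.
  have -> : lam * (t1 - (t1 - (S - f1 p) / lam)) = S - f1 p by field; rewrite gt_eqF.
  by move: sM; rewrite -/S; lra.
pose v p := u (tau p) - c1 / lam * (ln (1 + p) + (1 + p)^-1).
pose v' p := psi (sig (tau p)) * (f2 p / lam) - c1 / lam * ((1 + p)^-1 - (1 + p) ^- 2).
have dv (p : R) : 0 <= p -> is_derive p 1 v (v' p).
  move=> p0; have p1 : 0 < 1 + p by rewrite ltr_pwDl.
  have dtau : is_derive p 1 tau (f2 p / lam).
    have dd := df1 p.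
    have -> : tau = (fun q => (t1 - S / lam) + lam^-1 * f1 q).
      by apply/funext => q; rewrite /tau; ring.
    have dz : is_derive p 1 (fun q => lam^-1 * f1 q) (lam^-1 * f2 p) by exact: is_deriveZ.
    have dc := is_derive_cst (t1 - S / lam) p (1 : R).
    by apply: (is_derive_eq (is_deriveD dc dz)); rewrite add0r mulrC.
  have du' := @is_derive1_comp _ u tau p _ _ (du (tau p)) dtau.
  have d1 : is_derive p 1 (fun q : R => 1 + q) 1.
    by apply: (is_derive_eq (is_deriveD (is_derive_cst (1 : R) p (1 : R)) (is_derive_id p 1)));
       rewrite add0r.
  have dln : is_derive p 1 (fun q : R => ln (1 + q)) ((1 + p)^-1).
    have := @is_derive1_comp _ (@ln R) (fun q => 1 + q) p _ _ (is_derive1_ln p1) d1.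
    by rewrite mulr1.
  have dinv : is_derive p 1 (fun q : R => (1 + q)^-1) (- (1 + p) ^- 2).
    have := @is_deriveV R (fun q => 1 + q) p 1 1 _ d1.
    by rewrite /GRing.scale/= mulr1; apply; rewrite gt_eqF.
  have ds : is_derive p 1 (fun q : R => c1 / lam * (ln (1 + q) + (1 + q)^-1))
      (c1 / lam * ((1 + p)^-1 - (1 + p) ^- 2)).
    exact: (is_deriveZ (c1 / lam) (is_deriveD dln dinv)).
  exact: (is_deriveB du' ds).
have v'0 p : 0 <= p <= M -> 0 <= v' p.
  move=> /[dup] pM /andP[p0 p1]; rewrite subr_ge0.
  have h1 : p <= psi (sig (tau p)) by rewrite -{1}(psif1 p pM) psi_mono// sig_tau.
  have q0 : 0 < 1 + p by rewrite ltr_pwDl.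
  have -> : c1 / lam * ((1 + p)^-1 - (1 + p) ^- 2) = p * (c1 / (1 + p) ^+ 2 / lam).
    by field; rewrite !gt_eqF.
  apply: ler_pM => //; first by rewrite !divr_ge0 ?exprn_ge0 ?(ltW q0) ?(ltW lam0).
  by rewrite ler_wpM2r ?invr_ge0 ?(ltW lam0)// f2c.
have vM : v 0 <= v M.
  have dvM (x : R) : x \in `]0, M[%R -> is_derive x 1 v (v' x).
    by rewrite in_itv/= => /andP[/ltW x0 _]; exact: dv.
  have [|r] := MVT M0 dvM.
  - apply: derivable_within_continuous => x; rewrite in_itv/= => /andP[x0 _].
    by case: (dv x x0).
  - rewrite in_itv/= => /andP[r0 rM] E; rewrite -subr_ge0 E subr0 mulr_ge0 ?(ltW M0)//.
    by rewrite v'0// !ltW.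
move: vM; rewrite /v addr0 ln1 add0r invr1 mulr1.
have /u01/andP[u00 _] : 0 <= tau 0 <= 1.
  have /andP[-> tt] : 0 <= tau 0 <= t1 by apply: tau_itv; rewrite lexx ltW.
  exact: le_trans t11.
have /u01/andP[_ u11] : 0 <= tau M <= 1.
  have /andP[-> tt] : 0 <= tau M <= t1 by apply: tau_itv; rewrite lexx ltW.
  exact: le_trans t11.
move=> vM.
have M1 : 0 < (1 + M)^-1 by rewrite invr_gt0 ltr_wpDl.
have c1l : 0 <= c1 / lam by rewrite divr_ge0// ltW.
have : c1 / lam * (ln (1 + M) - 1) <= 1.
  have : 0 <= c1 / lam * (1 + M)^-1 by rewrite mulr_ge0// ltW.
  by move: vM u00 u11; rewrite mulrDr mulrBr mulr1; lra.
by rewrite mulrAC ler_pdivrMr// mul1r leNgt Mlarge.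
Qed.

End a_priori_bounds.

(** * The stress-strain relation *)

Section truncated_inverse.
Context {R : realType}.

(** The inverse of [f1] on [[-M, M]], composed with the clipping to
    [[-f1 M, f1 M]]; the lower bound [m] on the slope of [f1] makes it Lipschitz. *)
Lemma truncated_inverse (f1 : R -> R) (M m : R) : 0 < M -> 0 < m -> continuous f1 ->
  (forall p, f1 (- p) = - f1 p) ->
  (forall q p, - M <= q -> q <= p -> p <= M -> m * (p - q) <= f1 p - f1 q) ->
  exists psi : R -> R,
    [/\ forall x y, `|psi x - psi y| <= m^-1 * `|x - y|,
        forall x, `|psi x| <= M,
        forall x y, x <= y -> psi x <= psi y,
        forall p, - M <= p <= M -> psi (f1 p) = p
      & forall s, - f1 M <= s <= f1 M -> f1 (psi s) = s].
Proof.
move=> M0 m0 cf1 odd1 f1m.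
pose S := f1 M.
have NMM : - M <= M by rewrite ge0_cp ?(ltW M0).
have S0 : 0 < S.
  have := f1m (- M) M (lexx _) NMM (lexx _); rewrite odd1 !opprK -/S => H.
  have : 0 < S + S by rewrite (lt_le_trans _ H)// mulr_gt0// addr_gt0.
  by rewrite -mulr2n pmulrn_lgt0.
have NSS : - S <= S by rewrite ge0_cp ?(ltW S0).
pose clip (s : R) := Num.max (- S) (Num.min s S).
have clip_itv s : - S <= clip s <= S.
  by rewrite le_max lexx ge_max NSS ge_min lexx orbT.
have clip_id s : - S <= s <= S -> clip s = s.
  by move=> /andP[s1 s2]; rewrite /clip min_l// max_r.
have clip_mono x y : x <= y -> clip x <= clip y.
  move=> xy; rewrite /clip ge_max le_max lexx/= le_max le_min !ge_min xy lexx !orbT.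
  by rewrite ?orbT.
have clip_lip x y : x <= y -> clip y - clip x <= y - x.
  move=> xy; have /andP[cx _] := clip_itv x.
  have cx' : Num.min x S <= clip x by rewrite le_max lexx orbT.
  have y1 : Num.min y S <= y by rewrite ge_min lexx.
  have y2 : Num.min y S <= S by rewrite ge_min lexx orbT.
  rewrite lerBlDr {1}/clip ge_max; apply/andP; split; first by lra.
  by move: cx'; have [xS|xS] := leP x S; lra.
have ex s : exists p, - M <= p <= M /\ f1 p = clip s.
  have [|p] := @IVT R f1 (- M) M (clip s) NMM (continuous_subspaceT cf1).
    have /andP[c1 c2] := clip_itv s.
    by rewrite odd1 -/S min_l// max_r// c1 c2.
  by rewrite in_itv/= => pM fp; exists p.
have [psi psiP] := choice ex.
have psiM s : - M <= psi s <= M by case: (psiP s).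
have f1psi s : f1 (psi s) = clip s by case: (psiP s).
have mono x y : x <= y -> psi x <= psi y.
  move=> xy; rewrite leNgt; apply/negP => yx.
  have /andP[px _] := psiM y; have /andP[_ py] := psiM x.
  have := f1m _ _ px (ltW yx) py; rewrite !f1psi => H.
  have : 0 < clip x - clip y by rewrite (lt_le_trans _ H)// mulr_gt0// subr_gt0.
  by rewrite subr_gt0 ltNge clip_mono.
have inj p q : - M <= p <= M -> - M <= q <= M -> f1 p = f1 q -> p = q.
  wlog pq : p q / p <= q.
    by move=> H pM qM E; have [/H|/ltW/H] := leP p q; [apply|move=> ->].
  move=> /andP[p1 p2] /andP[q1 q2] E; apply/eqP; rewrite eq_le pq /=.
  by have := f1m _ _ p1 pq q2; rewrite E subrr pmulr_rle0// subr_le0.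
exists psi; split => //.
- move=> x y; wlog xy : x y / x <= y.
    move=> H; have [/H//|/ltW/H] := leP x y.
    by rewrite distrC (distrC y).
  rewrite distrC (distrC x) !ger0_norm ?subr_ge0 ?mono//.
  rewrite ler_pdivlMl// (le_trans _ (clip_lip _ _ xy))// -!f1psi.
  have /andP[px _] := psiM x; have /andP[_ py] := psiM y.
  exact: f1m (mono _ _ xy) _.
- by move=> x; rewrite ler_norml; exact: psiM.
- move=> p pM; apply: inj => //; rewrite f1psi clip_id//.
  have /andP[p1 p2] := pM.
  have H1 := f1m _ _ (lexx _) p1 p2; have H2 := f1m _ _ p1 p2 (lexx _).
  rewrite odd1 opprK -/S in H1; rewrite -/S in H2.
  have : 0 <= m * (p - - M) by rewrite mulr_ge0 ?(ltW m0)// subr_ge0.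
  have : 0 <= m * (M - p) by rewrite mulr_ge0 ?(ltW m0)// subr_ge0.
  by move=> ? ?; apply/andP; split; lra.
- by move=> s sS; rewrite f1psi clip_id.
Qed.

End truncated_inverse.

Section growth_condition.
Context {R : realType}.
Variables (F : R -> R) (c1 mu : R).
Hypothesis hF1 : condF1 F.
Hypothesis hF5 : condF5 F c1 mu.
Hypothesis c1_gt0 : 0 < c1.
Hypothesis mu_le2 : mu <= 2.

Lemma is_derive_F (p : R) : is_derive p 1 F (F^`() p).
Proof. by have [[dF _ _] _ _] := hF1; split => //; rewrite derive1E. Qed.

Lemma is_derive_F' (p : R) : is_derive p 1 F^`()%classic (F^`(2) p).
Proof.
have [[_ dF' _] _ _] := hF1; split; first exact: dF'.
by rewrite derive1nS derive1n1 derive1E.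
Qed.

Lemma F'_continuous : continuous F^`()%classic.
Proof. by apply: derivable_continuous => t; case: (is_derive_F' t). Qed.

Lemma F'_odd (p : R) : F^`()%classic (- p) = - F^`()%classic p.
Proof.
have [_ Feven _] := hF1.
have dN : is_derive p 1 (fun q : R => - q) (- 1).
  by have := is_deriveN (is_derive_id p (1 : R)).
have dFN := @is_derive1_comp _ F (fun q : R => - q) p _ _ (is_derive_F (- p)) dN.
have E : F \o (fun q : R => - q) = F by apply/funext => q /=; rewrite Feven.
rewrite E in dFN; have dF := is_derive_F p.
have := @derive_val _ _ _ _ _ _ _ dFN; rewrite (@derive_val _ _ _ _ _ _ _ dF).
by rewrite mulrN1 => ->; rewrite opprK.
Qed.

Lemma F'0 : F^`()%classic 0 = 0.
Proof. by have := F'_odd 0; rewrite oppr0; lra. Qed.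

(** The exponent [2] is the worst case allowed by the ellipticity. *)
Lemma F''_ge (p : R) : c1 / (1 + `|p|) ^+ 2 <= F^`(2) p.
Proof.
apply: le_trans (hF5 p); rewrite ler_wpM2l ?(ltW c1_gt0)//.
have p1 : 1 <= 1 + `|p| by rewrite lerDl.
have p0 : 0 < 1 + `|p| := lt_le_trans ltr01 p1.
rewrite lef_pV2 ?posrE ?powR_gt0 ?exprn_gt0// -powR_mulrn ?(ltW p0)//.
exact: ler_powR.
Qed.

Lemma F'_increment (M p q : R) : 0 < M -> - M <= q -> q <= p -> p <= M ->
  c1 / (1 + M) ^+ 2 * (p - q) <= F^`()%classic p - F^`()%classic q.
Proof.
move=> M0 Mq; rewrite le_eqVlt => /predU1P[-> _|qp pM]; first by rewrite !subrr mulr0.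
have [|r] := MVT qp (fun x _ => is_derive_F' x).
  by apply: continuous_subspaceT; exact: F'_continuous.
rewrite in_itv/= => /andP[qr rp] ->; rewrite ler_wpM2r ?subr_ge0 ?(ltW qp)//.
apply: le_trans (F''_ge r); rewrite ler_wpM2l ?(ltW c1_gt0)//.
have rM : `|r| <= M by rewrite ler_norml (le_trans Mq (ltW qr)) (le_trans (ltW rp) pM).
have r0 : 0 < 1 + `|r| by rewrite ltr_pwDl.
have MM : 0 < 1 + M by rewrite ltr_wpDl ?(ltW M0).
by rewrite lef_pV2 ?posrE ?exprn_gt0// ler_pXn2r ?nnegrE ?(ltW r0) ?(ltW MM)// lerD2l.
Qed.

Lemma F'_mono (p q : R) : p <= q -> F^`()%classic p <= F^`()%classic q.
Proof.
move=> pq; have [M [M0 Mp qM]] : exists M, [/\ 0 < M, - M <= p & q <= M].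
  exists (1 + `|p| + `|q|); split.
  - by rewrite -addrA ltr_pwDl// addr_ge0.
  - by rewrite lerNl (le_trans (ler_norm _))// normrN -addrA addrCA lerDl addr_ge0.
  - by rewrite (le_trans (ler_norm _))// lerDr addr_ge0.
rewrite -subr_ge0; apply: le_trans (F'_increment M0 Mp pq qM).
by rewrite mulr_ge0 ?subr_ge0// divr_ge0 ?(ltW c1_gt0)// exprn_ge0// addr_ge0 ?(ltW M0).
Qed.

Lemma F_convex (p q : R) : F p + F^`()%classic p * (q - p) <= F q.
Proof.
have [pq|qp|->] := ltgtP p q.
- have [|r] := MVT pq (fun x _ => is_derive_F x).
    by apply: continuous_subspaceT; apply: derivable_continuous => t; case: (is_derive_F t).
  rewrite in_itv/= => /andP[/ltW pr _] E; rewrite -lerBrDl E.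
  by rewrite ler_wpM2r ?subr_ge0 ?(ltW pq)// F'_mono.
- have [|r] := MVT qp (fun x _ => is_derive_F x).
    by apply: continuous_subspaceT; apply: derivable_continuous => t; case: (is_derive_F t).
  rewrite in_itv/= => /andP[_ /ltW rp] E.
  have H : F^`()%classic r * (p - q) <= F^`()%classic p * (p - q).
    by rewrite ler_wpM2r ?subr_ge0 ?(ltW qp)// F'_mono.
  have -> : F^`()%classic p * (q - p) = - (F^`()%classic p * (p - q)) by ring.
  by move: E H; lra.
- by rewrite subrr mulr0 addr0.
Qed.

(** A monotone odd function is bounded by its limit at infinity. *)
Lemma F'_le_lambda_infty (nu1 : R) : condF2 F nu1 ->
  forall p, `|F^`()%classic p| <= lambda_infty F.
Proof.
move=> hF2.
have le1 p : F^`()%classic p <= lambda_infty F.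
  apply: limr_ge; last first.
    by near=> q; apply: F'_mono; near: q; apply: nbhs_pinfty_ge; exact: num_real.
  apply: (cvgP (sup (range F^`()%classic))); apply: nondecreasing_cvgr.
    by move=> x y; exact: F'_mono.
  by exists nu1 => _ [x _ <-]; exact: ler_normlW.
move=> p; rewrite ler_norml le1 andbT lerNl -F'_odd; exact: le1.
Unshelve. all: by end_near. Qed.

End growth_condition.

(** * The Euler-Lagrange equation *)

Section euler_lagrange.
Context {R : realType}.
Variables (F g : R -> R) (c1 mu lam : R).
Hypothesis hF1 : condF1 F.
Hypothesis hF5 : condF5 F c1 mu.
Hypothesis c1_gt0 : 0 < c1.
Hypothesis mu_le2 : mu <= 2.
Hypothesis lam_gt0 : 0 < lam.
Hypothesis mg : measurable_fun (setT : set (measurableTypeR R)) g.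
Hypothesis g01 : forall t, 0 <= g t <= 1.

(** The size [M] of the truncation is fixed in advance by [lam] and [c1], large
    enough for [gradient_bound].  The lower bounds on [u] and on the stress are the
    upper bounds for the reflected problem, with [1 - u], [- sig] and
    [x |-> - psi (- x)] in place of [u], [sig] and [psi]. *)
Lemma euler_lagrange_solution : exists u p : R -> R,
  let h := cut (fun t => lam * (u t - g t)) in
  [/\ forall t : R, is_derive t 1 u (p t),
      exists K, forall s t, `|p t - p s| <= K * `|t - s|,
      bounded_borel h,
      \int[lebesgue_measure]_(t in I01) h t = 0
    & forall t, 0 <= t <= 1 -> F^`()%classic (p t) = primitive h t].
Proof.
(* chosen so that [ln (1 + M) = lam / c1 + 2] *)
pose M := expR (lam / c1 + 2) - 1.
have lc0 : 0 < lam / c1 + 2 by rewrite ltr_wpDl// divr_ge0// ltW.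
have M0 : 0 < M by rewrite subr_gt0 -[ltLHS]expR0 ltr_expR.
have Mlarge : lam < c1 * (ln (1 + M) - 1).
  rewrite /M (_ : 1 + (expR _ - 1) = expR (lam / c1 + 2)) ?expRK; last by ring.
  have -> : c1 * (lam / c1 + 2 - 1) = lam + c1 by field; rewrite gt_eqF.
  by rewrite ltrDl.
pose m := c1 / (1 + M) ^+ 2.
have m0 : 0 < m by rewrite divr_gt0// exprn_gt0// addr_gt0.
have F'inc q p : - M <= q -> q <= p -> p <= M ->
    m * (p - q) <= F^`()%classic p - F^`()%classic q.
  exact: (F'_increment hF1 hF5 c1_gt0 mu_le2 M0).
have [psi [psi_lip psi_bound psi_mono psiF' F'psi]] :=
  truncated_inverse M0 m0 (F'_continuous hF1) (F'_odd hF1) F'inc.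
have NM0 : - M <= 0 <= M by rewrite oppr_le0 (ltW M0).
have psi0 : psi 0 = 0 by rewrite -{1}(F'0 hF1) psiF'.
have im0 : 0 <= m^-1 by rewrite invr_ge0 ltW.
have [a [sig [a01 csig sig1 sigE sig0]]] := truncated_neumann_problem psi_lip
  psi_bound psi_mono psi0 im0 (ltW M0) lam_gt0 mg g01.
pose p := psi \o sig; pose u t := a + primitive p t.
have p0 : supported01 p by move=> t /sig0; rewrite /p /= => ->.
have cutp : cut p = p.
  apply/funext => t; have [It|It] := pselect (I01 t); first by rewrite cutE.
  by rewrite cut_supported// p0.
have cp : continuous p.
  move=> t; apply: continuous_comp; first exact: csig.
  exact: (psi_continuous psi_lip).
have du (t : R) : is_derive t 1 u (p t).
  have dp := is_derive_primitive p0 (bounded_borel_integrable01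
    (supported_bounded_borel cp p0)) (cp t).
  by apply: (is_derive_eq (is_deriveD (is_derive_cst a t (1 : R)) dp)); rewrite add0r.
have posE : position psi a sig = u by rewrite /position cutp.
pose h := cut (fun t => lam * (u t - g t)).
have forceE : force psi g lam a sig = h by rewrite /force posE.
have bh : bounded_borel h.
  rewrite -forceE.
  exact: (force_bounded_borel psi_lip psi_bound (ltW M0) lam_gt0 mg g01).
have h0 : supported01 h by exact: cut_supported.
have inth := bounded_borel_integrable01 bh.
rewrite forceE in sigE.
have sigz : sig 0 = 0 by apply: sig0; rewrite /I01/= in_itv/= ltxx.
have u0 : u 0 = a by rewrite /u primitive_le0// addr0.
have hval r c : (I01 r -> lam * (u r - g r) <= c) -> 0 <= c -> h r <= c.
  move=> H c0; have [Ir|Ir] := pselect (I01 r); first by rewrite /h cutE// H.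
  by rewrite h0.
have hval' r c : (I01 r -> c <= lam * (u r - g r)) -> c <= 0 -> c <= h r.
  move=> H c0; have [Ir|Ir] := pselect (I01 r); first by rewrite /h cutE// H.
  by rewrite h0.
have dsym (t : R) : is_derive t 1 (fun t => 1 - u t) (- psi (- - sig t)).
  have dut := du t; rewrite opprK.
  by apply: (is_derive_eq (is_deriveB (is_derive_cst (1 : R) t (1 : R)) dut)); rewrite sub0r.
have csigN : continuous (fun t => - sig t) by move=> t; apply: cvgN; exact: csig.
have psiN_mono x y : x <= y -> - psi (- x) <= - psi (- y).
  by move=> xy; rewrite lerN2 psi_mono// lerN2.
have psiN0 : - psi (- 0) = 0 by rewrite oppr0 psi0 oppr0.
have u_le1 : forall t, 0 <= t <= 1 -> u t <= 1.
  apply: (maximum_principle csig du psi_mono psi0 sig1).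
    by rewrite u0; case/andP: a01.
  move=> s t s0 st t1 H; rewrite -subr_ge0 !sigE -[leLHS](mul0r (t - s)).
  apply: primitive_ge => // r rst; apply: hval' => // _.
  rewrite mulr_ge0 ?(ltW lam_gt0)// subr_ge0; have /andP[_ g1] := g01 r.
  by rewrite (le_trans g1)// ltW// H.
have u_ge0 : forall t, 0 <= t <= 1 -> 0 <= u t.
  suff H : forall t, 0 <= t <= 1 -> 1 - u t <= 1.
    by move=> t /H; rewrite lerBlDr lerDl.
  apply: (@maximum_principle _ _ (fun t => - sig t) (fun x => - psi (- x))) => //.
  - by rewrite sig1 oppr0.
  - by rewrite u0 lerBlDr lerDl; case/andP: a01.
  - move=> s t s0 st t1 H; rewrite lerN2 -subr_le0 !sigE -[leRHS](mul0r (t - s)).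
    apply: primitive_le => // r rst; apply: hval => // _.
    rewrite pmulr_rle0// subr_le0; have /andP[g0 _] := g01 r.
    by apply: le_trans g0; have := H r rst; rewrite ltrBrDr gtrDl => /ltW.
have u01 t : 0 <= t <= 1 -> 0 <= u t <= 1 by move=> t01; rewrite u_ge0// u_le1.
have I01_cc r : I01 r -> 0 <= r <= 1.
  by rewrite /I01/= in_itv/= => /andP[r0 r1]; rewrite !ltW.
have siglip s t : 0 <= s -> s <= t -> t <= 1 -> sig t - sig s <= lam * (t - s).
  move=> s0 st t1; rewrite !sigE; apply: primitive_le => // r rst.
  apply: hval; last exact: ltW.
  move=> /I01_cc/u_le1 ur; rewrite ger_pMr//.
  by have /andP[gr _] := g01 r; move: ur gr; lra.
have siglipN s t : 0 <= s -> s <= t -> t <= 1 -> - sig t - - sig s <= lam * (t - s).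
  move=> s0 st t1; have H : - lam * (t - s) <= sig t - sig s.
    rewrite !sigE; apply: primitive_ge => // r rst.
    apply: hval'; last by rewrite oppr_le0 ltW.
    move=> /I01_cc/u_ge0 ur; rewrite -mulrN1 ler_pM2l//.
    by have /andP[_ gr] := g01 r; move: ur gr; lra.
  by move: H; rewrite mulNr; lra.
have f2c q : 0 <= q <= M -> c1 / (1 + q) ^+ 2 <= F^`(2) q.
  by move=> /andP[q0 _]; rewrite -{1}(ger0_norm q0); exact: (F''_ge hF5 c1_gt0 mu_le2).
have F'm := F'_mono hF1 hF5 c1_gt0 mu_le2.
have sig_lt : forall t, 0 <= t <= 1 -> sig t < F^`()%classic M.
  have psiF'0 q : 0 <= q <= M -> psi (F^`()%classic q) = q.
    by move=> /andP[q0 qM]; apply: psiF'; rewrite qM andbT (le_trans _ q0)// oppr_le0 ltW.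
  exact: (@gradient_bound _ u sig psi du psi_mono lam c1 M _ _ lam_gt0 M0 (ltW c1_gt0)
    (is_derive_F' hF1) F'm (F'0 hF1) psiF'0 f2c Mlarge sigz siglip u01).
have sig_gt : forall t, 0 <= t <= 1 -> - sig t < F^`()%classic M.
  apply: (@gradient_bound _ _ (fun t => - sig t) (fun x => - psi (- x)) dsym psiN_mono
    lam c1 M _ _ lam_gt0 M0 (ltW c1_gt0) (is_derive_F' hF1) F'm (F'0 hF1) _ f2c Mlarge _ siglipN) => //.
  - move=> q /andP[q0 qM]; rewrite -(F'_odd hF1) psiF' ?opprK// lerN2 qM/=.
    by rewrite (le_trans _ (ltW M0))// oppr_le0.
  - by rewrite sigz oppr0.
  - by move=> t /u01/andP[? ?]; apply/andP; split; lra.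
exists u, p; split => //.
- have [C hC] := bh.2; exists (m^-1 * C) => s t.
  rewrite /p /= (le_trans (psi_lip _ _))// -mulrA ler_wpM2l// !sigE.
  exact: primitive_lipschitz.
- by rewrite -(primitive_ge1 h0 (lexx 1)) -sigE.
- move=> t t01; rewrite /p /= F'psi ?sigE//.
  by rewrite -sigE lerNl !ltW// ?sig_gt ?sig_lt.
Qed.

End euler_lagrange.

(** * Distributional derivatives and their decompositions *)

Section chosen_objects.
Context {R : realType}.
Implicit Types (w : R -> R) (nu : signed_measure R).

Lemma distr_derivativeP w : BV01 w -> is_distr_derivative w (distr_derivative w).
Proof.
by move=> [_ H]; rewrite /distr_derivative; case: pselect => // h; exact: svalP (cid h).
Qed.

Lemma lebesgue_decompositionP nu : carried_by I01 nu ->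
  is_lebesgue_decomposition nu (lebesgue_decomposition nu).1 (lebesgue_decomposition nu).2.
Proof.
move=> nuI; rewrite /lebesgue_decomposition; case: pselect => [h|[]].
  exact: svalP (cid h).
exact: lebesgue_decomposition_exists.
Qed.

Lemma charge_integral_decomposition nu (g : R -> R) (nus : signed_measure R) phi :
  is_lebesgue_decomposition nu g nus -> bounded_borel phi ->
  charge_integral nu phi =
  \int[lebesgue_measure]_(t in I01) (phi t * g t) + charge_integral nus phi.
Proof.
move=> [intg _ nuE] bphi.
have [m1 [m2 [mE mint]]] := signed_density intg.
pose p : finmeas R := jordan_pos (hahn_posnegP nus).
pose n : finmeas R := jordan_neg (hahn_posnegP nus).
have [q1 [q1E q1int]] := finmeas_add m1 p.
have [q2 [q2E q2int]] := finmeas_add m2 n.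
rewrite (charge_integralE (m1 := q1) (m2 := q2))//.
  rewrite q1int// q2int// mint// /charge_integral.
  change (\int[m1]_t phi t + \int[p]_t phi t - (\int[m2]_t phi t + \int[n]_t phi t) =
    \int[m1]_t phi t - \int[m2]_t phi t + (\int[p]_t phi t - \int[n]_t phi t)).
  by ring.
move=> B mB; rewrite nuE// mE// q1E// q2E//.
have -> : nus B = (p B - n B)%E.
  by rewrite [LHS](jordan_decomp (hahn_posnegP nus) mB) /cadd/= cscaleN1.
by apply: fin_num_subACA; rewrite fin_num_measure.
Qed.

Lemma Rintegral_le_measure (m : finmeas R) (phi : R -> R) (C : R) :
  bounded_borel phi -> supported01 phi -> (forall t, `|phi t| <= C) ->
  `|\int[m]_t phi t| <= C * fine (m I01).
Proof.
move=> bphi phi0 hC.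
have intphi := bounded_borel_integrable m measurableT bphi.
rewrite (le_trans (le_normr_Rintegral _ intphi))//.
have -> : \int[m]_t `|phi t| = \int[m]_(t in I01) `|phi t|.
  rewrite [RHS]Rintegral_mkcond; apply: eq_Rintegral => t _; rewrite patchE.
  by case: ifPn => // /negP; rewrite inE => /phi0 ->; rewrite normr0.
rewrite -Rintegral_cst//; apply: le_Rintegral => //.
- apply: integrable_norm; exact: bounded_borel_integrable.
- apply: bounded_borel_integrable => //.
  apply: (@bounded_borel_continuous _ _ `|C|) => //; exact: cst_continuous.
Qed.

(** This is the inequality [\int sigma D^s w <= lambda_infty |D^s w|(0,1)] of the
    minimality argument, for [sigma] bounded by [lambda_infty]. *)
Lemma charge_integral_le_variation nu (phi : R -> R) (C : R) :
  bounded_borel phi -> supported01 phi -> (forall t, `|phi t| <= C) ->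
  charge_integral nu phi <= C * fine (variation_measure nu I01).
Proof.
move=> bphi phi0 hC; rewrite /charge_integral.
pose p : finmeas R := jordan_pos (hahn_posnegP nu).
pose n : finmeas R := jordan_neg (hahn_posnegP nu).
change (\int[p]_t phi t - \int[n]_t phi t <= C * fine (p I01 + n I01)%E).
rewrite fineD ?fin_num_measure// mulrDr.
have hp := Rintegral_le_measure p bphi phi0 hC.
have hn := Rintegral_le_measure n bphi phi0 hC.
apply: lerD; first exact: le_trans (ler_norm _) hp.
by apply: le_trans hn; rewrite -normrN ler_norm.
Qed.

End chosen_objects.

(** * Minimality *)

(** Expand [(w - g)^2] around [u]; the mixed term [2 (u - g) (w - u)] is
    [2 / lam] times [h (w - u)].  Finiteness of the first square suffices for all
    integrals, because [u - g] is bounded. *)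
Lemma quadratic_expansion (R : realType) (lam : R) (w u g h : R -> R) :
  0 < lam -> (forall t : R, I01 t -> h t = lam * (u t - g t)) -> bounded_borel h ->
  lebesgue_measure.-integrable I01 (EFin \o w) ->
  lebesgue_measure.-integrable I01 (EFin \o u) ->
  (\int[lebesgue_measure]_(t in I01) ((w t - g t) ^+ 2)%:E < +oo)%E ->
  [/\ lebesgue_measure.-integrable I01 (fun t => ((w t - g t) ^+ 2)%:E),
      lebesgue_measure.-integrable I01 (fun t => ((u t - g t) ^+ 2)%:E),
      lebesgue_measure.-integrable I01 (fun t => ((w t - u t) ^+ 2)%:E)
    & \int[lebesgue_measure]_(t in I01) (w t - g t) ^+ 2 =
      \int[lebesgue_measure]_(t in I01) (u t - g t) ^+ 2 +
      2 / lam * \int[lebesgue_measure]_(t in I01) (h t * (w t - u t)) +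
      \int[lebesgue_measure]_(t in I01) (w t - u t) ^+ 2].
Proof.
move=> lam0 hE bh intw intu finQ.
have mI := @measurable_I01 R.
have gE t : I01 t -> u t - g t = h t / lam.
  by move=> It; rewrite hE// mulrC mulKf// gt_eqF.
have inth := bounded_borel_integrable01 bh.
have intwu : lebesgue_measure.-integrable I01 (EFin \o (fun t => w t - u t)).
  by apply: eq_integrable (integrableB _ intw intu).
have inthl : lebesgue_measure.-integrable I01 (EFin \o (fun t => h t / lam)).
  by apply: eq_integrable (integrableZr _ lam^-1 inth).
have intk : lebesgue_measure.-integrable I01 (EFin \o (fun t => w t - g t)).
  apply: eq_integrable (integrableD _ intwu inthl) => // t /[!inE] It /=.
  by rewrite -EFinD -gE//; congr (_%:E); ring.
have intQ : lebesgue_measure.-integrable I01 (EFin \o (fun t => (w t - g t) ^+ 2)).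
  apply/integrableP; split.
    apply/measurable_EFinP; apply: measurable_funX.
    by apply/measurable_EFinP; exact: measurable_int intk.
  by under eq_integral do rewrite /= ger0_norm ?sqr_ge0//.
have inthh : lebesgue_measure.-integrable I01 (EFin \o (fun t => (u t - g t) ^+ 2)).
  have := integrable_bounded_mul mI bh inth.
  move=> /(integrableZl mI (lam^-1 ^+ 2)); apply: eq_integrable => // t /[!inE] It /=.
  by rewrite gE//; congr (_%:E); ring.
have inthwu : lebesgue_measure.-integrable I01
    (EFin \o (fun t => 2 / lam * (h t * (w t - u t)))).
  have := integrable_bounded_mul mI bh intwu.
  by move=> /(integrableZl mI (2 / lam)); apply: eq_integrable.
(* the square of [w - u] is integrable as a combination of the other terms *)
have intsum := integrableD mI inthh inthwu.
have expand t : I01 t -> (w t - g t) ^+ 2 =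
    (u t - g t) ^+ 2 + 2 / lam * (h t * (w t - u t)) + (w t - u t) ^+ 2.
  move=> It; rewrite hE//; field; exact: lt0r_neq0.
have intD : lebesgue_measure.-integrable I01 (EFin \o (fun t => (w t - u t) ^+ 2)).
  apply: eq_integrable (integrableB mI intQ intsum) => // t /[!inE] It.
  by rewrite /= expand//; congr (_%:E); ring.
split => //.
have -> : \int[lebesgue_measure]_(t in I01) (w t - g t) ^+ 2 =
    \int[lebesgue_measure]_(t in I01)
      ((u t - g t) ^+ 2 + 2 / lam * (h t * (w t - u t)) + (w t - u t) ^+ 2).
  by apply: eq_Rintegral => t /[!inE] It; exact: expand.
rewrite RintegralD// RintegralD// RintegralZl//.
exact: integrable_bounded_mul mI bh intwu.
Qed.

(** The functional without its fidelity term. *)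
Definition relaxed_energy (R : realType) (F w : R -> R) : \bar R :=
  (\int[lebesgue_measure]_(t in I01) (F (ac_density w t))%:E +
   (lambda_infty F)%:E * variation_measure (singular_part w) I01)%E.

Section energy.
Context {R : realType}.
Variables (F u p h : R -> R) (nu1 : R).
Hypothesis F_ge0 : forall x, 0 <= F x.
Hypothesis F_lin : forall x, F x <= nu1 * `|x|.
Hypothesis cF : continuous F.
Hypothesis F_conv : forall x y, F x + F^`()%classic x * (y - x) <= F y.
Hypothesis F'_le : forall x, `|F^`()%classic x| <= lambda_infty F.
Hypothesis du : forall t : R, is_derive t 1 u (p t).
Hypothesis cp : continuous p.
Hypothesis bh : bounded_borel h.
Hypothesis h0 : supported01 h.
Hypothesis h_mean0 : \int[lebesgue_measure]_(t in I01) h t = 0.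
Hypothesis stress : forall t, 0 <= t <= 1 -> F^`()%classic (p t) = primitive h t.

Let cu : continuous u.
Proof. by apply: derivable_continuous => t; case: (du t). Qed.

Lemma stress_supported : supported01 (primitive h).
Proof.
move=> t; rewrite /I01/= in_itv/= => /negP; rewrite negb_and -!leNgt => /orP[t0|t1].
  exact: primitive_le0.
by rewrite primitive_ge1.
Qed.

Lemma stress_bound t : `|primitive h t| <= lambda_infty F.
Proof.
have [It|/stress_supported ->] := pselect (I01 t); last first.
  by rewrite normr0 (le_trans _ (F'_le 0)).
rewrite -stress ?F'_le//; move: It; rewrite /I01/= in_itv/= => /andP[t0 t1].
by rewrite !ltW.
Qed.

Lemma stress_bounded_borel : bounded_borel (primitive h).
Proof.
apply: (bounded_borel_continuous (M := lambda_infty F)); last exact: stress_bound.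
have [C hC] := bh.2; apply: (@lipschitz_continuous _ _ C) => s t.
by apply: primitive_lipschitz => //; exact: bounded_borel_integrable01.
Qed.

Lemma F_integrable (q : R -> R) : lebesgue_measure.-integrable I01 (EFin \o q) ->
  lebesgue_measure.-integrable I01 (EFin \o (F \o q)).
Proof.
move=> intq.
have mq : measurable_fun I01 q by apply/measurable_EFinP; exact: measurable_int intq.
have intn : lebesgue_measure.-integrable I01 (fun t => (nu1 * `|q t|)%:E).
  have := integrable_norm intq => /(integrableZl (@measurable_I01 R) nu1).
  by apply: eq_integrable.
apply: le_integrable intn => //.
  apply/measurable_EFinP; apply: measurableT_comp mq.
  exact: continuous_measurable_fun.
move=> t _ /=; rewrite lee_fin ger0_norm//.
exact: le_trans (F_lin _) (ler_norm _).
Qed.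

Lemma smooth_BV : BV01 u.
Proof.
split; first exact: continuous_integrable01.
exact: smooth_distr_derivative du cp.
Qed.

(** The chosen decomposition of [Du] consists of some density and some singular
    part; the latter vanishes because it is carried by a null set, on which [Du] has
    no mass. *)
Lemma smooth_ac_density : ae_eq lebesgue_measure I01 (ac_density u) p /\
  variation_measure (singular_part u) I01 = 0%E.
Proof.
have nuP := distr_derivativeP smooth_BV.
have nuE := smooth_distr_derivative_unique du cp nuP.
have := lebesgue_decompositionP nuP.1.
rewrite -/(ac_density u) -/(singular_part u).
set q := ac_density u; set nus := singular_part u => -[intq [N [mN N0 Ns]] decE].
have intp := continuous_integrable01 cp.
have fin_int (k : R -> R) (B : set (measurableTypeR R)) :
    lebesgue_measure.-integrable I01 (EFin \o k) -> measurable B ->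
    (\int[lebesgue_measure]_(t in B `&` I01) (k t)%:E \is a fin_num)%E.
  move=> intk mB; apply: integrable_fin_num; first exact: measurableI.
  by apply: integrableS intk => //; exact: measurableI.
have nusE B : measurable B -> nus B = (\int[lebesgue_measure]_(t in B `&` I01) (p t)%:E
    - \int[lebesgue_measure]_(t in B `&` I01) (q t)%:E)%E.
  move=> mB; rewrite -nuE// decE//.
  by apply: fin_num_addKl; [exact: fin_int|exact: fin_num_measure].
(* outside [N] by singularity, inside by absolute continuity of both [Du] and [q] *)
have nus0 B : measurable B -> nus B = 0%E.
  move=> mB; rewrite (chargeDI nus mB mN).
  have -> : nus (B `\` N) = 0%E.
    by apply: Ns; [exact: measurableD|rewrite setDE -setIA setICl setI0].
  rewrite add0e nusE; last exact: measurableI.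
  have null (k : R -> R) : lebesgue_measure.-integrable I01 (EFin \o k) ->
      (\int[lebesgue_measure]_(t in B `&` N `&` I01) (k t)%:E = 0)%E.
    move=> intk; apply: null_set_integral => //.
    - by apply: measurableI => //; exact: measurableI.
    - by apply: measurable_funS (measurable_int _ intk) => //; exact: subIsetr.
    - apply/eqP; rewrite eq_le measure_ge0 andbT -N0; apply: le_measure; rewrite ?inE//.
        by apply: measurableI => //; exact: measurableI.
      by move=> t [[]].
  by rewrite !null// sube0.
split; last first.
  have [[mP _] [mN' _] _ _] := hahn_posnegP nus.
  rewrite /variation_measure /charge_variation /= jordan_posE jordan_negE.
  have mI := @measurable_I01 R.
  rewrite cjordan_posE cjordan_negE /crestr0 mem_set// /crestr.
  rewrite nus0; last exact: measurableI.
  by rewrite nus0 ?oppe0 ?adde0//; exact: measurableI.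
suff : ae_eq lebesgue_measure I01 (EFin \o q) (EFin \o p).
  by apply: filterS => t /= qt /qt [].
apply: integral_ae_eq => //; first exact: measurable_int intp.
move=> E EI mE; have EE : E `&` I01 = E by rewrite setIidl.
have fq := fin_int _ _ intq mE; have fp := fin_int _ _ intp mE.
have := nusE E mE; rewrite nus0// EE => /esym pq; apply/esym.
by rewrite EE in fq fp; exact: fin_num_sub0_eq pq.
Qed.

Lemma smooth_energy :
  relaxed_energy F u = (\int[lebesgue_measure]_(t in I01) F (p t))%:E.
Proof.
rewrite /relaxed_energy.
have [aeq ->] := smooth_ac_density; rewrite mule0 adde0.
have intp := continuous_integrable01 cp.
have intq : lebesgue_measure.-integrable I01 (EFin \o ac_density u).
  by have [] := lebesgue_decompositionP (distr_derivativeP smooth_BV).1.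
have intFp := F_integrable intp; have intFq := F_integrable intq.
rewrite /Rintegral fineK; last exact: integrable_fin_num.
apply: ae_eq_integral => //; [exact: measurable_int intFq|exact: measurable_int intFp|].
by apply: filterS aeq => t /= qt /qt ->.
Qed.

(** The subgradient inequality of the relaxed energy at [u]: minus [h], the
    distributional derivative of minus the stress, is a subgradient.  The densities
    are compared by convexity of [F], the singular part by the bound on the stress,
    and both [w] and [u] are integrated by parts against the stress. *)
Lemma BV_energy_ge w : BV01 w -> exists2 e : R,
  relaxed_energy F w = e%:E
  & \int[lebesgue_measure]_(t in I01) F (p t) -
    \int[lebesgue_measure]_(t in I01) (h t * (w t - u t)) <= e.
Proof.
move=> Bw; rewrite /relaxed_energy; have intw := Bw.1.
have nuP := distr_derivativeP Bw.
have dec := lebesgue_decompositionP nuP.1.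
rewrite -/(ac_density w) -/(singular_part w) in dec.
have [intq _ _] := dec.
set q := ac_density w in dec intq *; set nus := singular_part w in dec *.
have intp := continuous_integrable01 cp.
have intFp := F_integrable intp; have intFq := F_integrable intq.
have intu := continuous_integrable01 cu.
have finV : variation_measure nus I01 \is a fin_num.
  pose m : finmeas R := jordan_pos (hahn_posnegP nus).
  pose n : finmeas R := jordan_neg (hahn_posnegP nus).
  change ((m I01 + n I01)%E \is a fin_num).
  by rewrite fin_numD !fin_num_measure.
exists (\int[lebesgue_measure]_(t in I01) F (q t) +
        lambda_infty F * fine (variation_measure nus I01)).
  by rewrite EFinD EFinM (fineK finV) /Rintegral fineK//; exact: integrable_fin_num.
have bP := stress_bounded_borel.
have partw := BV_by_parts intw nuP bh h0 h_mean0.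
rewrite (charge_integral_decomposition dec bP) in partw.
have nuuP := distr_derivativeP smooth_BV.
have partu := BV_by_parts intu nuuP bh h0 h_mean0.
have nuuE : charge_integral (distr_derivative u) (primitive h) =
    \int[lebesgue_measure]_(t in I01) (primitive h t * p t).
  have [m1 [m2 [mE mint]]] := signed_density intp.
  rewrite mint// (charge_integralE (m1 := m1) (m2 := m2))// => B mB.
  by rewrite (smooth_distr_derivative_unique du cp nuuP)// mE.
rewrite nuuE in partu.
have sing := charge_integral_le_variation nus bP stress_supported stress_bound.
have inthw := integrable_bounded_mul (@measurable_I01 R) bh intw.
have inthu := integrable_bounded_mul (@measurable_I01 R) bh intu.
have intPp := integrable_bounded_mul (@measurable_I01 R) bP intp.
have intPq := integrable_bounded_mul (@measurable_I01 R) bP intq.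
have -> : \int[lebesgue_measure]_(t in I01) (h t * (w t - u t)) =
    \int[lebesgue_measure]_(t in I01) (h t * w t) -
    \int[lebesgue_measure]_(t in I01) (h t * u t).
  by rewrite -RintegralB//; apply: eq_Rintegral => t _; rewrite mulrBr.
have conv : \int[lebesgue_measure]_(t in I01) (F (p t) + primitive h t * q t) <=
    \int[lebesgue_measure]_(t in I01) (F (q t) + primitive h t * p t).
  apply: le_Rintegral => //.
  - by apply: eq_integrable (integrableD _ intFp intPq).
  - by apply: eq_integrable (integrableD _ intFq intPp).
  - move=> t; rewrite /I01/= in_itv/= => /andP[t0 t1].
    have := F_conv (p t) (q t); rewrite stress ?(ltW t0) ?(ltW t1)//.
    by move=> /= ?; lra.
rewrite !RintegralD// in conv.
by move: partw partu conv sing; lra.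
Qed.

End energy.

(** The linear term of the expanded fidelity cancels the term in [h] of the
    subgradient inequality, and what remains is the square of the distance.  When the
    fidelity of [w] is infinite there is nothing to compare. *)
Lemma strong_minimality (R : realType) (F f g u h : R -> R) (lam P : R) :
  0 < lam -> measurable_fun (I01 : set (measurableTypeR R)) f ->
  ae_eq lebesgue_measure I01 f g ->
  BV01 u -> bounded_borel h -> (forall t : R, I01 t -> h t = lam * (u t - g t)) ->
  relaxed_energy F u = P%:E ->
  (forall w, BV01 w -> exists2 e : R, relaxed_energy F w = e%:E
     & P - \int[lebesgue_measure]_(t in I01) (h t * (w t - u t)) <= e) ->
  energyK F lam f u \is a fin_num /\
  forall w, BV01 w ->
    (energyK F lam f u +
     (lam / 2)%:E * \int[lebesgue_measure]_(t in I01) ((w t - u t) ^+ 2)%:E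
     <= energyK F lam f w)%E.
Proof.
move=> lam0 mf fg Bu bh hE uE wE.
have mI := @measurable_I01 R; have intu := Bu.1.
have mg : measurable_fun (I01 : set (measurableTypeR R)) g.
  have inth := bounded_borel_integrable01 bh.
  have : lebesgue_measure.-integrable I01 (EFin \o g).
    apply: eq_integrable (integrableB mI intu (integrableZr mI lam^-1 inth)) => // t.
    move=> /[!inE] It /=; rewrite hE//; congr (_%:E); field.
    exact: lt0r_neq0.
  by move=> intg; apply/measurable_EFinP; exact: measurable_int intg.
have fidelityE w : lebesgue_measure.-integrable I01 (EFin \o w) ->
    (\int[lebesgue_measure]_(t in I01) ((w t - f t) ^+ 2)%:E =
     \int[lebesgue_measure]_(t in I01) ((w t - g t) ^+ 2)%:E)%E.
  move=> intw; have mw : measurable_fun (I01 : set (measurableTypeR R)) w.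
    by apply/measurable_EFinP; exact: measurable_int intw.
  apply: ae_eq_integral => //.
  - by apply/measurable_EFinP; apply: measurable_funX; exact: measurable_funB.
  - by apply/measurable_EFinP; apply: measurable_funX; exact: measurable_funB.
  - by apply: filterS fg => t /= ft /ft ->.
have KE w : BV01 w -> energyK F lam f w = (relaxed_energy F w +
    (lam / 2)%:E * \int[lebesgue_measure]_(t in I01) ((w t - g t) ^+ 2)%:E)%E.
  by move=> Bw; rewrite /energyK (fidelityE _ Bw.1).
have intug : lebesgue_measure.-integrable I01 (EFin \o (fun t => (u t - g t) ^+ 2)).
  have inth := bounded_borel_integrable01 bh.
  have := integrable_bounded_mul mI bh inth.
  move=> /(integrableZl mI (lam^-1 ^+ 2)); apply: eq_integrable => // t /[!inE] It /=.
  by rewrite hE//; congr (_%:E); field; exact: lt0r_neq0.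
have EFinR (k : R -> R) : lebesgue_measure.-integrable I01 (EFin \o k) ->
    (\int[lebesgue_measure]_(t in I01) (k t)%:E =
     (\int[lebesgue_measure]_(t in I01) k t)%:E)%E.
  by move=> intk; rewrite /Rintegral fineK//; exact: integrable_fin_num intk.
have KuE : energyK F lam f u =
    (P + lam / 2 * \int[lebesgue_measure]_(t in I01) (u t - g t) ^+ 2)%:E.
  by rewrite KE// uE EFinR// -EFinM -EFinD.
split; first by rewrite KuE.
move=> w Bw; have [e eE eP] := wE w Bw; rewrite (KE w Bw) eE.
have [finQ|] := boolP (\int[lebesgue_measure]_(t in I01) ((w t - g t) ^+ 2)%:E < +oo)%E.
  have [i1 i2 i3 Qeq] := quadratic_expansion lam0 hE bh Bw.1 intu finQ.
  rewrite KuE EFinR// EFinR// -!EFinM -!EFinD lee_fin Qeq.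
  have lamE : lam / 2 * (2 / lam) = 1 by field; exact: lt0r_neq0.
  by rewrite !mulrDr mulrA lamE mul1r; lra.
rewrite -leNgt leye_eq => /eqP ->.
by rewrite gt0_muley ?lte_fin ?divr_gt0// addey// leey.
Qed.

(** * Regularity of the minimizer *)

Lemma smooth_good_representative (R : realType) (u : R -> R) :
  continuous u -> good_representative u.
Proof.
move=> cu.
have cl (t : R) : u s @[s --> t^'-] --> u t := cvg_at_left_filter (cu t).
have cr (t : R) : u s @[s --> t^'+] --> u t := cvg_at_right_filter (cu t).
split => //.
- by move=> t _; split; apply/cvg_ex; exists (u t).
- rewrite (_ : mkset _ = set0) ?countable0//; apply/seteqP; split => // t [_].
  move=> [l [r [/(cvg_lim (@Rhausdorff R)) <- /(cvg_lim (@Rhausdorff R)) <-]]].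
  rewrite (cvg_lim (@Rhausdorff R) (cl t)) (cvg_lim (@Rhausdorff R) (cr t)).
  by rewrite eqxx.
- by move=> t _ _; exact: cu.
Qed.

Lemma is_derive_class_C11 (R : realType) (u p : R -> R) (K : R) :
  (forall t : R, is_derive t 1 u (p t)) ->
  (forall s t : R, `|p t - p s| <= K * `|t - s|) -> class_C11 u.
Proof.
move=> du pK; exists p; split.
- move=> t _; have [dut dE] := du t.
  have := dut; rewrite /derivable => /cvg_ex[l ul].
  have lE : l = p t.
    by rewrite -dE; apply/esym; apply: cvg_lim ul; exact: Rhausdorff.
  rewrite {}lE in ul.
  apply/cvgrPdist_le => e e0.
  have /cvgrPdist_le /(_ e e0) := ul; rewrite near_withinE.
  move=> /nbhs_ballP[r r0 H]; rewrite !near_withinE.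
  apply/nbhs_ballP; exists r => // s ts st _.
  have := H (s - t); rewrite /ball/= sub0r normrN distrC => /(_ ts).
  rewrite subr_eq0 => /(_ st).
  by rewrite /shift/= /GRing.scale/= mulr1 subrK mulrC.
- by apply: continuous_subspaceT; exact: lipschitz_continuous pK.
- by exists K => -[s t] _ /=; rewrite (pK t s).
Qed.

Lemma F_linear_growth (R : realType) (F : R -> R) (nu1 x : R) :
  condF1 F -> condF2 F nu1 -> F x <= nu1 * `|x|.
Proof.
move=> hF1 hF2; have [_ Feven F0] := hF1.
wlog x0 : x / 0 <= x.
  move=> H; have [/H//|/ltW x0] := leP 0 x.
  by rewrite -Feven -normrN; apply: H; rewrite oppr_ge0.
move: x0; rewrite le_eqVlt => /predU1P[<-|x0]; first by rewrite F0 normr0 mulr0.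
have [|r _] := MVT x0 (fun y _ => is_derive_F hF1 y).
  by apply: continuous_subspaceT; apply: derivable_continuous => t;
    case: (is_derive_F hF1 t).
rewrite F0 !subr0 (gtr0_norm x0) => ->; rewrite ler_wpM2r ?(ltW x0)//.
exact: le_trans (ler_norm _) (hF2 r).
Qed.

(** The equation is solved for a datum that is Borel on the whole line and satisfies
    [0 <= g <= 1] everywhere; extension by zero and clipping provide one. *)
Lemma unit_valued_representative (R : realType) (f : R -> R) :
  measurable_fun (I01 : set (measurableTypeR R)) f ->
  {ae lebesgue_measure, forall t : R, I01 t -> 0 <= f t <= 1} ->
  exists g : R -> R, [/\ measurable_fun (setT : set (measurableTypeR R)) g,
    forall t, 0 <= g t <= 1 & ae_eq lebesgue_measure I01 f g].
Proof.
move=> mf f01; pose k := f \_ I01.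
exists (cst 0 \max (k \min cst 1)); split.
- apply: measurable_maxr => //; apply: measurable_minr => //.
  exact: (measurable_restrictT f (@measurable_I01 R)).1 mf.
- by move=> t /=; rewrite le_max lexx/= ge_max ler01/= ge_min lexx orbT.
- have FF := @ae_filter_ringOfSetsType _ _ R (@lebesgue_measure R).
  apply: (@filterS _ _ FF _ _ _ f01) => t ft It; have /andP[f0 f1] := ft It.
  by rewrite /= /k patchE mem_set//= (min_idPl f1) (max_idPr f0).
Qed.

Theorem theorem1p5 (R : realType) (f F : R -> R)
    (nu1 nu2 nu3 c1 mu lam : R)
    (f_Linfty : Linfty01 f)
    (f_01 : {ae lebesgue_measure, forall t, I01 t -> 0 <= f t <= 1})
    (F_ge0 : forall p, 0 <= F p)
    (nu1_gt0 : 0 < nu1) (nu2_gt0 : 0 < nu2) (c1_gt0 : 0 < c1)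
    (mu_gt1 : 1 < mu) (mu_le2 : mu <= 2)
    (hF1 : condF1 F) (hF2 : condF2 F nu1) (hF3 : condF3 F nu2 nu3)
    (hF4 : condF4 F) (hF5 : condF5 F c1 mu)
    (lam_gt0 : 0 < lam) :
  exists u : R -> R,
    [/\ BV_minimizer F lam f u,
        forall v, BV_minimizer F lam f v -> ae_eq lebesgue_measure I01 v u,
        good_representative u
      & class_C11 u].
Proof.
have [mf _] := f_Linfty.
have [g [mg g01 fg]] := unit_valued_representative mf f_01.
have [u [p]] := euler_lagrange_solution hF1 hF5 c1_gt0 mu_le2 lam_gt0 mg g01.
set h := cut _ => -[du [K pK] bh h_mean0 stress].
have cp : continuous p by exact: lipschitz_continuous pK.
have cu : continuous u by apply: derivable_continuous => t; case: (du t).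
have cF : continuous F by apply: derivable_continuous => x; case: (is_derive_F hF1 x).
have F_lin x : F x <= nu1 * `|x| by exact: F_linear_growth.
have F_conv := F_convex hF1 hF5 c1_gt0 mu_le2.
have F'_le := F'_le_lambda_infty hF1 hF5 c1_gt0 mu_le2 hF2.
have h0 : supported01 h by exact: cut_supported.
have Bu : BV01 u := smooth_BV du cp.
have [finKu Ku] := strong_minimality lam_gt0 mf fg Bu bh (fun t It => cutE _ It)
  (smooth_energy F_ge0 F_lin cF du cp)
  (BV_energy_ge F_ge0 F_lin cF F_conv F'_le du cp bh h0 h_mean0 stress).
have dist_ge0 w : (0 <= (lam / 2)%:E *
    \int[lebesgue_measure]_(t in I01) ((w t - u t) ^+ 2)%:E)%E.
  rewrite mule_ge0 ?lee_fin ?divr_ge0 ?(ltW lam_gt0)//.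
  by apply: integral_ge0 => t _; rewrite lee_fin sqr_ge0.
exists u; split.
- split => // w Bw; apply: le_trans (Ku w Bw).
  by rewrite leeDl.
- move=> v [Bv vmin]; have := le_trans (Ku v Bv) (vmin u Bu).
  rewrite -leeBrDl// subee// => D0.
  have {}D0 : (\int[lebesgue_measure]_(t in I01) ((v t - u t) ^+ 2)%:E = 0)%E.
    apply/eqP; rewrite eq_le integral_ge0 ?andbT; last first.
      by move=> t _; rewrite lee_fin sqr_ge0.
    by move: D0; rewrite pmule_rle0// lte_fin divr_gt0.
  have mv : measurable_fun (I01 : set (measurableTypeR R)) v.
    by apply/measurable_EFinP; exact: measurable_int Bv.1.
  have mu' : measurable_fun (I01 : set (measurableTypeR R)) u.
    by apply/measurable_EFinP; exact: measurable_int Bu.1.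
  have : ae_eq lebesgue_measure I01 (fun t => ((v t - u t) ^+ 2)%:E) (cst 0%E).
    apply/ae_eq_integral_abs.
    - exact: measurable_I01.
    - by apply/measurable_EFinP; apply: measurable_funX; exact: measurable_funB.
    - by under eq_integral do rewrite /= ger0_norm ?sqr_ge0//.
  apply: filterS => t /= vu It; have /eqP := vu It.
  by rewrite eqe sqrf_eq0 subr_eq0 => /eqP.
- exact: smooth_good_representative.
- exact: is_derive_class_C11 du pK.
Qed.
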